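(* Let $\sigma>0$, $r,q\in\mathbb{R}$, $T>0$, $\beta\in\mathbb{R}$, $i\in\mathbb{R}$, $L>0$, $K\ge 0$, $\tau_1,\tau_2\in\mathbb{R}$ and $\tau_3>0$. Consider the terminal value problem \[ \frac{\partial V}{\partial t}+\frac12\sigma^2X^2\frac{\partial^2V}{\partial X^2}+(r-q)X\frac{\partial V}{\partial X}-rV=0,\quad 0<t<T,\ X>0, \] \[ V(X,T)=X^{\beta}\,N\!\left[\delta\!\left(\tfrac{X^{i}}{L},\tau_1,\tau_2,\tau_3\right)\right]\cdot 1\{X>K\}. \] Its solution has the representation \[ V(X,\tau;\tau_1,\tau_2,\tau_3,i,L,K)=X^{\beta}e^{\mu(\beta)\tau}N_2(a_1,a_2;\rho), \] where $\tau=T-t$, \[ \mu(\beta)=-r+\beta\Big[r-q-\frac{\sigma^2}{2}(1-\beta)\Big],\qquad \rho=i\sqrt{\frac{\tau}{\tau_3+i^2\tau}}, \] \[ a_2=\Big[\ln\frac{X}{K}+\Big(r-q-\frac{\sigma^2}{2}\Big)\tau+\sigma^2\beta\tau\Big](\sigma\sqrt{\tau})^{-1}=\delta(X/K,\tau,\beta\tau,\tau), \] \[ a_1=\Big[\ln\frac{X^{i}}{L}+\Big(r-q-\frac{\sigma^2}{2}\Big)(\tau_1+i\tau)+\sigma^2(\tau_2+i\beta\tau)\Big]\big(\sigma\sqrt{\tau_3+i^2\tau}\big)^{-1}=\delta\big(X^{i}/L,\ \tau_1+i\tau,\ \tau_2+i\beta\tau,\ \tau_3+i^2\tau\big). \]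
   Context: $N(x)=\frac{1}{\sqrt{2\pi}}\int_{-\infty}^{x}e^{-t^2/2}\,dt$ is the standard normal distribution function, and \[ N_2(a_1,a_2;\rho)=\frac{1}{2\pi\sqrt{1-\rho^2}}\int_{-\infty}^{a_1}\int_{-\infty}^{a_2}\exp\!\Big(-\frac{y_1^2-2\rho y_1y_2+y_2^2}{2(1-\rho^2)}\Big)\,dy_2\,dy_1 \] is the bivariate standard normal distribution function with correlation $\rho$. For $y>0$ and real $\tau_1,\tau_2$, $\tau_3>0$, the notation $\delta$ means \[ \delta(y,\tau_1,\tau_2,\tau_3)=\Big[\ln y+\Big(r-q-\frac{\sigma^2}{2}\Big)\tau_1+\sigma^2\tau_2\Big](\sigma\sqrt{\tau_3})^{-1}. \] $1\{\cdot\}$ denotes the indicator function.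
   Formalization: The formula is shown to be a solution (uniqueness, false without a growth condition, is not claimed); V(X,T) is taken as the limit τ→0+ for each X≠K, since at X=K>0 that limit is half of K^β N[δ] rather than 0; for K=0, a_2 is read as +∞. *)

(* Defs.v *)
From Stdlib Require Import Reals.
From Coquelicot Require Import Coquelicot.
Open Scope R_scope.

Definition upper_filter (a : Rbar) : (R -> Prop) -> Prop :=
  match a with
  | Finite x => at_point x
  | _ => Rbar_locally a
  end.

Definition Nstd (x : R) : R :=
  / sqrt (2 * PI) *
  RInt_gen (fun t => exp (- t ^ 2 / 2)) (Rbar_locally m_infty) (at_point x).

(* Bivariate standard normal distribution function, with the second upper
   bound allowed to be +oo (N2(a1,+oo;rho) = N(a1)). *)
Definition N2gen (a1 : R) (a2 : Rbar) (rho : R) : R :=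
  / (2 * PI * sqrt (1 - rho ^ 2)) *
  RInt_gen
    (fun y1 => RInt_gen
       (fun y2 => exp (- (y1 ^ 2 - 2 * rho * y1 * y2 + y2 ^ 2) / (2 * (1 - rho ^ 2))))
       (Rbar_locally m_infty) (upper_filter a2))
    (Rbar_locally m_infty) (at_point a1).

Definition N2 (a1 a2 rho : R) : R := N2gen a1 (Finite a2) rho.

Definition delta (r q sigma : R) (y t1 t2 t3 : R) : R :=
  (ln y + (r - q - sigma ^ 2 / 2) * t1 + sigma ^ 2 * t2) / (sigma * sqrt t3).

Definition mu (r q sigma beta : R) : R :=
  - r + beta * (r - q - sigma ^ 2 / 2 * (1 - beta)).

(* The claimed solution, in the variables (X, tau) with tau = T - t. *)
Definition Vsol (r q sigma beta i L K t1 t2 t3 : R) (X tau : R) : R :=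
  let rho := i * sqrt (tau / (t3 + i ^ 2 * tau)) in
  let a1 := delta r q sigma (Rpower X i / L) (t1 + i * tau) (t2 + i * beta * tau)
              (t3 + i ^ 2 * tau) in
  (* K = 0: ln(X/K) = +oo, so a2 = +oo *)
  let a2 : Rbar := if Req_EM_T K 0 then p_infty
                   else Finite (delta r q sigma (X / K) tau (beta * tau) tau) in
  Rpower X beta * exp (mu r q sigma beta * tau) * N2gen a1 a2 rho.

Definition payoff (r q sigma beta i L K t1 t2 t3 : R) (X : R) : R :=
  Rpower X beta * Nstd (delta r q sigma (Rpower X i / L) t1 t2 t3) *
  (if Rlt_dec K X then 1 else 0).

(* Main.v *)
Require Import Defs.
From Stdlib Require Import Reals Lra Psatz FunctionalExtensionality.
From Coquelicot Require Import Coquelicot.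
Open Scope R_scope.

(** Plackett's formula
    [N2 (a, b; r) = N a * N b + int_0^r phi2 (a, b; t) dt], with [phi2] the
    bivariate normal density, turns the improper double integral into an
    integral over a compact interval whose partial derivatives are explicit:
    [phi (a) N ((b - r a) / sqrt (1 - r^2))] in [a], the same with [a] and [b]
    exchanged in [b], and [phi2 (a, b; r)] in [r]. In the variable [ln X], after
    removing the factor [X^beta exp (mu tau)], the Black-Scholes equation becomes
    a heat equation with constant drift; the terms carrying [N] cancel pairwise,
    and the terms carrying [phi2] cancel because of the value of [d rho / d tau].
    As [tau] tends to [0], [rho] tends to [0] and [a2] to plus or minus infinity
    according to the side of the strike. *)

(** No derivative is ever taken under an improper integral, which would require domination
    arguments. Each improper integral is evaluated by exhibiting a primitive with known limits at
    the ends: [gauss_prim] for [Nstd], a multiple of [conditional_cdf] for the inner integral of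
    [N2gen], and a multiple of [plackett] in its first argument for the outer one. Plackett's
    formula is thus a consequence of differentiating its right-hand side. The limits of [Nstd] at
    both infinities rest on the value of the Gaussian integral, which is computed here from scratch.
    A zero strike makes the second bound infinite; [N2gen] then collapses to [Nstd] and is treated
    as a separate, one-dimensional case. *)

(** * Improper integrals by primitives *)

(** On each segment the integral is a difference of values of [G], and this difference converges
    along the product filter. Keeping [Fa] and [Fb] abstract covers finite and infinite ends at
    once. *)
Lemma is_RInt_gen_primitive (G g : R -> R) (Fa Fb : (R -> Prop) -> Prop)
  {FFa : Filter Fa} {FFb : Filter Fb} (la lb : R) :
  (forall x, is_derive G x (g x)) -> (forall x, continuous g x) ->
  filterlim G Fa (locally la) -> filterlim G Fb (locally lb) ->
  is_RInt_gen g Fa Fb (lb - la).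
Proof.
  intros HG Hg Ha Hb P HP.
  assert (Hlim : filterlim (fun ab => G (snd ab) - G (fst ab))
                   (filter_prod Fa Fb) (locally (lb - la))).
  { apply (filterlim_comp_2 (G := locally lb) (H := locally la)
             (fun ab => G (snd ab)) (fun ab => G (fst ab)) Rminus).
    - apply filterlim_comp with Fb; [apply filterlim_snd | exact Hb].
    - apply filterlim_comp with Fa; [apply filterlim_fst | exact Ha].
    - apply (filterlim_comp_2 (G := locally lb) (H := locally (- la)) fst
               (fun x => - snd x) Rplus).
      + apply filterlim_fst.
      + apply filterlim_comp with (locally la); [apply filterlim_snd |].
        apply (filterlim_opp (K := R_AbsRing) (V := R_NormedModule) la).
      + apply (filterlim_plus (K := R_AbsRing) (V := R_NormedModule) lb (- la)). }
  generalize (Hlim P HP); unfold filtermap, filtermapi; apply filter_imp; intros [u v] Hv; simpl in *.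
  exists (G v - G u); split; [| exact Hv].
  apply (is_RInt_derive G g u v); intros; [apply HG | apply Hg].
Qed.

Lemma RInt_gen_primitive (G g : R -> R) (Fa Fb : (R -> Prop) -> Prop)
  {FFa : ProperFilter Fa} {FFb : ProperFilter Fb} (la lb : R) :
  (forall x, is_derive G x (g x)) -> (forall x, continuous g x) ->
  filterlim G Fa (locally la) -> filterlim G Fb (locally lb) ->
  RInt_gen g Fa Fb = lb - la.
Proof.
  intros HG Hg Ha Hb; apply is_RInt_gen_unique.
  exact (is_RInt_gen_primitive G g Fa Fb la lb HG Hg Ha Hb).
Qed.

Lemma filterlim_at_point (G : R -> R) (x : R) :
  filterlim G (at_point x) (locally (G x)).
Proof.
  intros P HP; unfold filtermap, at_point; exact (locally_singleton _ _ HP).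
Qed.

(** * The Gaussian integral *)

Definition gauss (t : R) : R := exp (- t ^ 2 / 2).

Definition gauss_prim (x : R) : R := RInt gauss 0 x.

Lemma continuous_gauss (x : R) : continuous gauss x.
Proof.
  apply (ex_derive_continuous gauss); unfold gauss; auto_derive; trivial.
Qed.

Lemma is_derive_gauss (x : R) : is_derive gauss x (- x * gauss x).
Proof. unfold gauss; auto_derive; [trivial | unfold Rdiv; simpl; field]. Qed.

Lemma ex_RInt_gauss (a b : R) : ex_RInt gauss a b.
Proof.
  apply (ex_RInt_continuous (V := R_CompleteNormedModule)).
  intros; apply continuous_gauss.
Qed.

Lemma is_derive_gauss_prim (x : R) : is_derive gauss_prim x (gauss x).
Proof.
  apply (is_derive_RInt gauss gauss_prim 0 x); [| apply continuous_gauss].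
  apply filter_forall; intros y; apply (RInt_correct gauss 0 y), ex_RInt_gauss.
Qed.

Lemma gauss_prim_opp (x : R) : gauss_prim (- x) = - gauss_prim x.
Proof.
  unfold gauss_prim.
  assert (H : is_RInt (fun y => - gauss (- y)) 0 x (RInt gauss 0 (- x))).
  { apply (is_RInt_comp_opp gauss 0 x).
    rewrite Ropp_0; apply (RInt_correct gauss 0 (- x)), ex_RInt_gauss. }
  rewrite <- (is_RInt_unique _ _ _ _ H).
  rewrite (RInt_ext _ (fun y => opp (gauss y))).
  - apply (RInt_opp (V := R_CompleteNormedModule) gauss), ex_RInt_gauss.
  - intros y _; unfold gauss; change opp with Ropp; simpl; do 3 f_equal; ring.
Qed.

(* [gauss_prim x ^ 2 + 2 * int_0^1 polar_term x u du] does not depend on [x]: its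
   value at [0] and its limit at infinity give the Gaussian integral. *)
Definition polar_term (x u : R) : R := exp (- x ^ 2 * (1 + u ^ 2) / 2) / (1 + u ^ 2).

Lemma one_plus_sqr_pos (u : R) : 0 < 1 + u ^ 2.
Proof. nra. Qed.

Lemma is_derive_polar_term (x u : R) :
  is_derive (fun z => polar_term z u) x (- x * exp (- x ^ 2 * (1 + u ^ 2) / 2)).
Proof.
  assert (Hu := one_plus_sqr_pos u).
  unfold polar_term; auto_derive; [simpl in Hu; lra |]; unfold Rdiv; simpl in *; field; lra.
Qed.

Lemma continuous_polar_term (x u : R) : continuous (polar_term x) u.
Proof.
  assert (Hu := one_plus_sqr_pos u).
  apply (ex_derive_continuous (polar_term x)); unfold polar_term; auto_derive.
  simpl in Hu; lra.
Qed.

Lemma ex_RInt_polar_term (x a b : R) : ex_RInt (polar_term x) a b.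
Proof.
  apply (ex_RInt_continuous (V := R_CompleteNormedModule)).
  intros; apply continuous_polar_term.
Qed.

(** The differentiated integrand splits as [- gauss x] times [x * gauss (x * u)], and the
    substitution [v = x * u] turns the integral of the second factor over [0, 1] into
    [gauss_prim x]. *)
Lemma is_derive_polar_RInt (x : R) :
  is_derive (fun z => RInt (polar_term z) 0 1) x (- (gauss x * gauss_prim x)).
Proof.
  assert (HD : forall u v, Derive (fun z => polar_term z v) u
                 = - u * exp (- u ^ 2 * (1 + v ^ 2) / 2)).
  { intros; apply is_derive_unique, is_derive_polar_term. }
  replace (- (gauss x * gauss_prim x))
    with (RInt (fun t => Derive (fun z => polar_term z t) x) 0 1).
  - apply (is_derive_RInt_param polar_term 0 1 x).
    + apply filter_forall; intros y t _; eexists; apply is_derive_polar_term.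
    + intros t _.
      apply (continuity_2d_pt_ext (fun u v => - u * exp (- u ^ 2 * (1 + v ^ 2) / 2)));
        [now intros |].
      apply continuity_2d_pt_mult.
      * apply continuity_2d_pt_opp, continuity_2d_pt_id1.
      * apply (continuity_1d_2d_pt_comp exp).
        { apply derivable_continuous_pt, derivable_pt_exp. }
        unfold Rdiv; simpl.
        repeat (apply continuity_2d_pt_mult || apply continuity_2d_pt_plus
                || apply continuity_2d_pt_opp || apply continuity_2d_pt_id1
                || apply continuity_2d_pt_id2 || apply continuity_2d_pt_const).
    + apply filter_forall; intros; apply ex_RInt_polar_term.
  - replace (- (gauss x * gauss_prim x)) with (scal (- gauss x) (gauss_prim x))
      by (unfold scal; simpl; unfold mult; simpl; ring).
    apply is_RInt_unique.
    apply (is_RInt_ext (fun t => scal (- gauss x) (scal x (gauss (x * t + 0))))).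
    + intros t _; rewrite HD; unfold scal; simpl; unfold mult; simpl; unfold gauss.
      transitivity (- x * (exp (- x ^ 2 / 2) * exp (- (x * t + 0) ^ 2 / 2)));
        [ring | rewrite <- exp_plus; do 2 f_equal; field].
    + apply (is_RInt_scal (V := R_NormedModule)).
      apply (is_RInt_comp_lin gauss x 0 0 1).
      rewrite Rmult_0_r, Rmult_1_r, !Rplus_0_r.
      apply (RInt_correct gauss 0 x), ex_RInt_gauss.
Qed.

Lemma polar_RInt_0 : RInt (polar_term 0) 0 1 = PI / 4.
Proof.
  rewrite <- atan_1; apply is_RInt_unique.
  replace (atan 1) with (minus (atan 1) (atan 0))
    by (rewrite atan_0; change (atan 1 + - 0 = atan 1); ring).
  apply (is_RInt_ext (fun u => / (1 + u ^ 2))).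
  - intros; unfold polar_term; replace (- 0 ^ 2 * (1 + x ^ 2) / 2) with 0 by field.
    rewrite exp_0; symmetry; apply Rmult_1_l.
  - apply (is_RInt_derive atan (fun u => / (1 + u ^ 2))); intros x _.
    + apply is_derive_Reals, derivable_pt_lim_atan.
    + apply (ex_derive_continuous (fun u => / (1 + u ^ 2))).
      auto_derive; assert (H := one_plus_sqr_pos x); simpl in H; lra.
Qed.

Lemma gauss_prim_sqr (x : R) :
  gauss_prim x ^ 2 + 2 * RInt (polar_term x) 0 1 = PI / 2.
Proof.
  set (h := fun y => gauss_prim y ^ 2 + 2 * RInt (polar_term y) 0 1).
  assert (Hh : forall y, is_derive h y 0).
  (* Stated for an arbitrary [B], so that the parameter integral enters only through its known
     derivative. *)
  { assert (Hgen : forall (B : R -> R) (y dB : R), is_derive B y dB ->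
      is_derive (fun z => gauss_prim z ^ 2 + 2 * B z) y
        (2 * gauss_prim y * gauss y + 2 * dB)).
    { intros B y dB HB; assert (H1 := is_derive_gauss_prim y).
      auto_derive.
      - split; [eexists; exact H1 |]; split; [eexists; exact HB | trivial].
      - rewrite (is_derive_unique (fun x : R => gauss_prim x) _ _ H1).
        rewrite (is_derive_unique (fun x : R => B x) _ _ HB); ring. }
    intros y; replace 0 with (2 * gauss_prim y * gauss y
      + 2 * - (gauss y * gauss_prim y)) by ring.
    apply (Hgen (fun z => RInt (polar_term z) 0 1)), is_derive_polar_RInt. }
  change (h x = PI / 2).
  assert (E : h x = h 0).
  { destruct (Req_dec x 0) as [-> | Hx]; [reflexivity |].
    destruct (MVT_gen h 0 x (fun _ => 0)) as [c [_ Hc]].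
    - intros; apply Hh.
    - intros; apply continuity_pt_filterlim.
      apply (ex_derive_continuous h); eexists; apply Hh.
    - lra. }
  rewrite E; unfold h; rewrite polar_RInt_0.
  unfold gauss_prim; rewrite RInt_point; change zero with 0; field.
Qed.

(** This is [1 + z <= exp z] at [z = x ^ 2 / 2], inverted; a rational bound suffices for the decay
    at infinity. *)
Lemma gauss_le_inv (x : R) : gauss x <= 2 / (2 + x ^ 2).
Proof.
  unfold gauss.
  assert (H := exp_ineq1_le (x ^ 2 / 2)).
  replace (- x ^ 2 / 2) with (- (x ^ 2 / 2)) by field; rewrite exp_Ropp.
  assert (0 <= x ^ 2) by apply pow2_ge_0.
  replace (2 / (2 + x ^ 2)) with (/ (1 + x ^ 2 / 2)) by (field; lra).
  apply Rinv_le_contravar; lra.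
Qed.

Lemma gauss_pos (x : R) : 0 < gauss x.
Proof. apply exp_pos. Qed.

Lemma is_lim_gauss_p : is_lim gauss p_infty 0.
Proof.
  apply (is_lim_le_le_loc (fun _ => 0) (fun x => 2 / x)).
  - exists 1; intros x Hx; split; [left; apply gauss_pos |].
    eapply Rle_trans; [apply gauss_le_inv |].
    unfold Rdiv; apply Rmult_le_compat_l; [lra |]; apply Rinv_le_contravar; nra.
  - apply is_lim_const.
  - replace (Finite 0) with (Rbar_mult 2 (Rbar_inv p_infty)) by (simpl; f_equal; ring).
    apply (is_lim_scal_l (fun x => / x) 2 p_infty).
    apply (is_lim_inv (fun x => x) p_infty p_infty); [apply is_lim_id | discriminate].
Qed.

Lemma polar_RInt_bounds (x : R) : 0 <= RInt (polar_term x) 0 1 <= gauss x.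
Proof.
  assert (Hc : forall u, 0 <= polar_term x u <= gauss x).
  { intros u; unfold polar_term, gauss.
    assert (Hu := one_plus_sqr_pos u).
    assert (He : exp (- x ^ 2 * (1 + u ^ 2) / 2) <= exp (- x ^ 2 / 2)).
    { destruct (Req_dec (x * u) 0) as [E | E].
      - right; f_equal; replace (- x ^ 2 * (1 + u ^ 2) / 2)
          with (- x ^ 2 / 2 - (x * u) ^ 2 / 2) by field.
        rewrite E; field.
      - left; apply exp_increasing; assert (0 < (x * u) ^ 2) by (apply pow2_gt_0; auto).
        nra. }
    assert (Hp := exp_pos (- x ^ 2 * (1 + u ^ 2) / 2)).
    split.
    - apply Rlt_le, Rdiv_lt_0_compat; lra.
    - apply Rle_trans with (2 := He).
      apply Rmult_le_reg_r with (1 + u ^ 2); [lra |].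
      unfold Rdiv; rewrite Rmult_assoc, Rinv_l, Rmult_1_r by lra.
      assert (0 <= u ^ 2) by apply pow2_ge_0; nra. }
  split.
  - apply RInt_ge_0; [lra | apply ex_RInt_polar_term |]; intros; apply Hc.
  - replace (gauss x) with (RInt (fun _ => gauss x) 0 1)
      by (rewrite RInt_const; unfold scal; simpl; unfold mult; simpl; ring).
    apply RInt_le; [lra | apply ex_RInt_polar_term | apply ex_RInt_const |].
    intros; apply Hc.
Qed.

(** The polar integral is squeezed to 0 by [gauss], so the square of the primitive tends to
    [PI / 2]; for positive arguments the primitive is nonnegative, which selects the positive
    root. *)
Lemma is_lim_gauss_prim_p : is_lim gauss_prim p_infty (sqrt (PI / 2)).
Proof.
  assert (HP := PI_RGT_0).
  apply (is_lim_ext_loc (fun x => sqrt (PI / 2 - 2 * RInt (polar_term x) 0 1))).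
  { exists 0; intros x Hx.
    replace (PI / 2 - 2 * RInt (polar_term x) 0 1) with (gauss_prim x ^ 2)
      by (rewrite <- (gauss_prim_sqr x); ring).
    rewrite sqrt_pow2; [reflexivity |].
    apply RInt_ge_0; [lra | |].
    - apply ex_RInt_gauss.
    - intros; left; apply gauss_pos. }
  assert (Hl : is_lim (fun x => PI / 2 - 2 * RInt (polar_term x) 0 1) p_infty (PI / 2)).
  { apply (is_lim_le_le_loc (fun x => PI / 2 - 2 * gauss x) (fun _ => PI / 2)).
    - exists 0; intros x _; assert (H := polar_RInt_bounds x); lra.
    - replace (Finite (PI / 2)) with (Finite (PI / 2 - 2 * 0)) by (f_equal; ring).
      apply (is_lim_minus' (fun _ => PI / 2) (fun x => 2 * gauss x)).
      + apply is_lim_const.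
      + apply (is_lim_scal_l gauss 2 p_infty 0), is_lim_gauss_p.
    - apply is_lim_const. }
  eapply filterlim_comp; [exact Hl |].
  apply (continuous_sqrt (PI / 2)).
Qed.

Lemma is_lim_gauss_prim_m : is_lim gauss_prim m_infty (- sqrt (PI / 2)).
Proof.
  apply (is_lim_ext (fun x => - gauss_prim (- x))).
  { intros; rewrite gauss_prim_opp; ring. }
  apply (is_lim_opp (fun x => gauss_prim (- x)) m_infty (sqrt (PI / 2))).
  apply (is_lim_comp gauss_prim (fun x => - x) m_infty (sqrt (PI / 2)) p_infty).
  - apply is_lim_gauss_prim_p.
  - apply (is_lim_opp (fun x => x) m_infty m_infty), is_lim_id.
  - exists 0; intros; discriminate.
Qed.

(** * The standard normal distribution function *)

Definition normal_pdf (x : R) : R := / sqrt (2 * PI) * gauss x.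

Lemma sqrt_2PI_pos : 0 < sqrt (2 * PI).
Proof. apply sqrt_lt_R0; assert (H := PI_RGT_0); lra. Qed.

Lemma sqrt_half_PI : sqrt (PI / 2) = sqrt (2 * PI) / 2.
Proof.
  assert (HP := PI_RGT_0).
  replace (PI / 2) with (2 * PI / (2 * 2)) by field.
  rewrite sqrt_div by lra; rewrite sqrt_square by lra; reflexivity.
Qed.

(** The constant [/ 2] is the mass of the negative half-line, [sqrt (PI / 2) / sqrt (2 * PI)]. *)
Lemma Nstd_gauss_prim (x : R) : Nstd x = / 2 + / sqrt (2 * PI) * gauss_prim x.
Proof.
  assert (H := sqrt_2PI_pos).
  change (/ sqrt (2 * PI) * RInt_gen gauss (Rbar_locally m_infty) (at_point x)
    = / 2 + / sqrt (2 * PI) * gauss_prim x).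
  rewrite (RInt_gen_primitive gauss_prim gauss (Rbar_locally m_infty) (at_point x)
             (- sqrt (PI / 2)) (gauss_prim x)).
  - rewrite sqrt_half_PI; field; lra.
  - apply is_derive_gauss_prim.
  - apply continuous_gauss.
  - apply is_lim_gauss_prim_m.
  - apply filterlim_at_point.
Qed.

Lemma is_derive_Nstd (x : R) : is_derive Nstd x (normal_pdf x).
Proof.
  apply (is_derive_ext (fun y => / 2 + / sqrt (2 * PI) * gauss_prim y)).
  { intros; symmetry; apply Nstd_gauss_prim. }
  unfold normal_pdf; assert (H := is_derive_gauss_prim x).
  auto_derive; [eexists; exact H |].
  rewrite (is_derive_unique (fun x : R => gauss_prim x) _ _ H); ring.
Qed.

Lemma continuous_Nstd (x : R) : continuous Nstd x.
Proof. apply (ex_derive_continuous Nstd); eexists; apply is_derive_Nstd. Qed.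

Lemma is_lim_Nstd_p : is_lim Nstd p_infty 1.
Proof.
  assert (H := sqrt_2PI_pos).
  apply (is_lim_ext (fun y => / 2 + / sqrt (2 * PI) * gauss_prim y)).
  { intros; symmetry; apply Nstd_gauss_prim. }
  replace (Finite 1) with (Finite (/ 2 + / sqrt (2 * PI) * sqrt (PI / 2)))
    by (rewrite sqrt_half_PI; f_equal; field; lra).
  apply (is_lim_plus' (fun _ => / 2)); [apply is_lim_const |].
  apply (is_lim_scal_l gauss_prim _ p_infty (sqrt (PI / 2))), is_lim_gauss_prim_p.
Qed.

Lemma is_lim_Nstd_m : is_lim Nstd m_infty 0.
Proof.
  assert (H := sqrt_2PI_pos).
  apply (is_lim_ext (fun y => / 2 + / sqrt (2 * PI) * gauss_prim y)).
  { intros; symmetry; apply Nstd_gauss_prim. }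
  replace (Finite 0) with (Finite (/ 2 + / sqrt (2 * PI) * - sqrt (PI / 2)))
    by (rewrite sqrt_half_PI; f_equal; field; lra).
  apply (is_lim_plus' (fun _ => / 2)); [apply is_lim_const |].
  apply (is_lim_scal_l gauss_prim _ m_infty (- sqrt (PI / 2))), is_lim_gauss_prim_m.
Qed.

(** * The bivariate density and the conditional distribution *)

Definition binormal_pdf (a b t : R) : R :=
  exp (- (a ^ 2 - 2 * t * a * b + b ^ 2) / (2 * (1 - t ^ 2)))
    / (2 * PI * sqrt (1 - t ^ 2)).

Lemma one_minus_sqr_pos (t : R) : -1 < t < 1 -> 0 < 1 - t ^ 2.
Proof. nra. Qed.

Lemma sqrt_one_minus_sqr_pos (t : R) : -1 < t < 1 -> 0 < sqrt (1 - t ^ 2).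
Proof. intros H; apply sqrt_lt_R0, one_minus_sqr_pos, H. Qed.

Lemma sqr_sqrt_one_minus_sqr (t : R) :
  -1 < t < 1 -> sqrt (1 - t ^ 2) ^ 2 = 1 - t ^ 2.
Proof. intros H; apply pow2_sqrt; apply one_minus_sqr_pos in H; lra. Qed.

Lemma binormal_pdf_sym (a b t : R) : binormal_pdf a b t = binormal_pdf b a t.
Proof.
  unfold binormal_pdf; do 4 f_equal; ring.
Qed.

(** Completing the square, [a^2 - 2tab + b^2 = (1 - t^2) a^2 + (b - ta)^2]: the density is the
    marginal in [a] times the conditional density of [b]. *)
Lemma binormal_pdf_factor (a b t : R) : -1 < t < 1 ->
  binormal_pdf a b t
  = normal_pdf a * normal_pdf ((b - t * a) / sqrt (1 - t ^ 2)) / sqrt (1 - t ^ 2).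
Proof.
  intros H; assert (Hs := sqrt_one_minus_sqr_pos t H).
  assert (Hp := one_minus_sqr_pos t H).
  assert (HP := PI_RGT_0); assert (H2 := sqrt_2PI_pos).
  unfold normal_pdf, gauss, binormal_pdf.
  transitivity (exp (- a ^ 2 / 2) * exp (- ((b - t * a) / sqrt (1 - t ^ 2)) ^ 2 / 2)
                 / (2 * PI * sqrt (1 - t ^ 2))).
  - rewrite <- exp_plus; do 2 f_equal.
    replace (((b - t * a) / sqrt (1 - t ^ 2)) ^ 2)
      with ((b - t * a) ^ 2 / sqrt (1 - t ^ 2) ^ 2) by (field; lra).
    rewrite sqr_sqrt_one_minus_sqr by exact H; field; lra.
  - rewrite <- (sqrt_sqrt (2 * PI)) at 1 by lra; field; lra.
Qed.

(** All three arguments move together because both bounds and the correlation depend on time. The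
    isolated term [r / (1 - r^2)] in the coefficient of [dr] comes from the normalising root. *)
Lemma is_derive_binormal_pdf (a b r : R -> R) (x da db dr : R) :
  is_derive a x da -> is_derive b x db -> is_derive r x dr -> -1 < r x < 1 ->
  is_derive (fun y => binormal_pdf (a y) (b y) (r y)) x
    (binormal_pdf (a x) (b x) (r x)
     * ((r x * b x - a x) / (1 - r x ^ 2) * da + (r x * a x - b x) / (1 - r x ^ 2) * db
        + (r x / (1 - r x ^ 2) + a x * b x / (1 - r x ^ 2)
           - r x * (a x ^ 2 - 2 * r x * a x * b x + b x ^ 2) / (1 - r x ^ 2) ^ 2) * dr)).
Proof.
  intros Ha Hb Hr H.
  assert (Hp := one_minus_sqr_pos _ H); assert (Hs := sqrt_one_minus_sqr_pos _ H).
  assert (Hq := sqr_sqrt_one_minus_sqr _ H); assert (HP := PI_RGT_0).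
  set (s := sqrt (1 - r x ^ 2)) in *.
  assert (Hsd : is_derive (fun y => sqrt (1 - r y ^ 2)) x (- r x * dr / s)).
  { auto_derive.
    - repeat split; [eexists; exact Hr |]; simpl in Hp; lra.
    - rewrite (is_derive_unique (fun x : R => r x) _ _ Hr).
      change (1 + - (r x * (r x * 1))) with (1 - r x ^ 2); fold s; field; lra. }
  assert (HE : is_derive (fun y => exp (- (a y ^ 2 - 2 * r y * a y * b y + b y ^ 2)
                 / (2 * (1 - r y ^ 2)))) x
     (exp (- (a x ^ 2 - 2 * r x * a x * b x + b x ^ 2) / (2 * (1 - r x ^ 2)))
     * ((r x * b x - a x) / (1 - r x ^ 2) * da + (r x * a x - b x) / (1 - r x ^ 2) * db
        + (a x * b x / (1 - r x ^ 2)
           - r x * (a x ^ 2 - 2 * r x * a x * b x + b x ^ 2) / (1 - r x ^ 2) ^ 2) * dr))).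
  { auto_derive.
    - repeat split; try (eexists; eassumption); simpl in Hp; lra.
    - rewrite (is_derive_unique (fun x : R => r x) _ _ Hr).
      rewrite (is_derive_unique (fun x : R => a x) _ _ Ha).
      rewrite (is_derive_unique (fun x : R => b x) _ _ Hb).
      unfold Rdiv, Rminus; simpl in *; field; lra. }
  unfold binormal_pdf; fold s.
  set (E := fun y => exp _) in HE.
  change (exp (- (a x ^ 2 - 2 * r x * a x * b x + b x ^ 2) / (2 * (1 - r x ^ 2))))
    with (E x) in *.
  apply (is_derive_ext (fun y => E y / (2 * PI * sqrt (1 - r y ^ 2)))); [reflexivity |].
  (* The root is replaced by an opaque [S], so that its derivative enters in the short form
     [Hsd]. *)
  assert (Hgen : forall S dE, S x = s -> is_derive E x dE -> is_derive S x (- r x * dr / s) ->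
    is_derive (fun y => E y / (2 * PI * S y)) x
     (dE / (2 * PI * s) + E x / (2 * PI * s) * (r x * dr / s ^ 2))).
  { intros S dE HS H1 H2; auto_derive.
    - split; [eexists; exact H1 |]; split; [eexists; exact H2 |]; split; [|trivial].
      rewrite HS; apply Rgt_not_eq; nra.
    - rewrite (is_derive_unique (fun x : R => E x) _ _ H1).
      rewrite (is_derive_unique (fun x : R => S x) _ _ H2); rewrite HS; field; lra. }
  evar_last; [apply (Hgen (fun y => sqrt (1 - r y ^ 2))); [reflexivity | exact HE | exact Hsd] |].
  rewrite Hq; field; lra.
Qed.

(* [conditional_cdf a b t / normal_pdf a] is the probability that the second
   component is below [b] when the first one equals [a]. *)
Definition conditional_cdf (a b t : R) : R :=
  normal_pdf a * Nstd ((b - t * a) / sqrt (1 - t ^ 2)).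

(** The argument of [Nstd] has derivative [(tb - a) / (1 - t^2)^(3/2)] in [t]; one root is absorbed
    into the density. The result is exactly the derivative of [binormal_pdf] in its first
    argument. *)
Lemma is_derive_conditional_cdf_corr (a b t : R) : -1 < t < 1 ->
  is_derive (conditional_cdf a b) t
    (binormal_pdf a b t * ((t * b - a) / (1 - t ^ 2))).
Proof.
  intros H; rewrite binormal_pdf_factor by exact H.
  assert (Hp := one_minus_sqr_pos _ H); assert (Hs := sqrt_one_minus_sqr_pos _ H).
  assert (Hq := sqr_sqrt_one_minus_sqr _ H).
  unfold conditional_cdf.
  assert (Hu : is_derive (fun t => (b - t * a) / sqrt (1 - t ^ 2)) t
                 ((t * b - a) / sqrt (1 - t ^ 2) ^ 3)).
  { auto_derive.
    - simpl in *; repeat split; [lra |]; apply Rgt_not_eq; exact Hs.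
    - change (1 + - (t * (t * 1))) with (1 - t ^ 2).
      set (s := sqrt (1 - t ^ 2)) in *.
      (* Splits [a] as [t^2 a + s^2 a], the form in which the derivative of the quotient delivers
         it. *)
      replace ((t * b - a)) with (t * b - t ^ 2 * a - s ^ 2 * a) by (rewrite Hq; ring).
      field; lra. }
  assert (HN := is_derive_comp Nstd _ t _ _ (is_derive_Nstd _) Hu).
  assert (HS := is_derive_scal _ _ (normal_pdf a) _ HN).
  evar_last; [exact HS |].
  unfold scal; simpl; unfold mult; simpl.
  change (1 - t * (t * 1)) with (1 - t ^ 2); set (s := sqrt (1 - t ^ 2)) in *.
  rewrite <- Hq; field; lra.
Qed.

Lemma is_derive_conditional_cdf_bound (a b t : R) : -1 < t < 1 ->
  is_derive (fun y => conditional_cdf a y t) b (binormal_pdf a b t).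
Proof.
  intros H; rewrite binormal_pdf_factor by exact H.
  assert (Hs := sqrt_one_minus_sqr_pos _ H).
  unfold conditional_cdf; set (s := sqrt (1 - t ^ 2)) in *.
  assert (Hu : is_derive (fun y => (y - t * a) / s) b (/ s)).
  { auto_derive; [trivial | field; lra]. }
  assert (HN := is_derive_comp Nstd _ b _ _ (is_derive_Nstd _) Hu).
  assert (HS := is_derive_scal _ _ (normal_pdf a) _ HN).
  evar_last; [exact HS |].
  unfold scal; simpl; unfold mult; simpl; field; lra.
Qed.

(** * Plackett's formula and its derivatives *)

(** The integral over the correlation from 0 to [r] is rescaled by [t = r * u], so that its bounds
    stay fixed when [r] varies and negative [r] needs no separate orientation. *)
Definition plackett (a b r : R) : R :=
  Nstd a * Nstd b + RInt (fun u => r * binormal_pdf a b (r * u)) 0 1.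

Lemma continuous_binormal_pdf_corr (a b r u : R) : -1 < r * u < 1 ->
  continuous (fun u => r * binormal_pdf a b (r * u)) u.
Proof.
  intros H; apply (continuous_scal_r r (fun u => binormal_pdf a b (r * u))).
  apply (ex_derive_continuous (fun u => binormal_pdf a b (r * u))).
  eexists; apply (is_derive_binormal_pdf (fun _ => a) (fun _ => b) (fun u => r * u) u 0 0 r);
    [apply (is_derive_const a) | apply (is_derive_const b) | | exact H].
  auto_derive; [trivial | ring].
Qed.

Lemma mul_unit_interval (r u : R) : -1 < r < 1 -> 0 <= u <= 1 -> -1 < r * u < 1.
Proof. nra. Qed.

Lemma ex_RInt_binormal_pdf_corr (a b r : R) : -1 < r < 1 ->
  ex_RInt (fun u => r * binormal_pdf a b (r * u)) 0 1.
Proof.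
  intros H; apply (ex_RInt_continuous (V := R_CompleteNormedModule)); intros u Hu.
  rewrite Rmin_left, Rmax_right in Hu by lra.
  apply continuous_binormal_pdf_corr, mul_unit_interval; assumption.
Qed.

Lemma locally_2d_proj1 (P : R -> Prop) (x y : R) :
  locally x P -> locally_2d (fun u _ => P u) x y.
Proof. intros [d Hd]; exists d; intros u v Hu _; apply Hd, Hu. Qed.

Lemma continuity_2d_pt_proj1 (f : R -> R) (x y : R) :
  continuous f x -> continuity_2d_pt (fun u _ => f u) x y.
Proof.
  intros H; apply (continuity_1d_2d_pt_comp f (fun u _ => u)).
  - apply continuity_pt_filterlim, H.
  - apply continuity_2d_pt_id1.
Qed.

(* Plackett's identity: the derivative in [a] of the density is the derivative
   in the correlation of [conditional_cdf a b], so the integral over the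
   correlation of the differentiated density telescopes. *)
Lemma is_derive_plackett (a b r da db dr : R -> R) (x : R) :
  locally x (fun y => is_derive a y (da y) /\ is_derive b y (db y)
                      /\ is_derive r y (dr y)) ->
  continuous da x -> continuous db x -> continuous dr x -> -1 < r x < 1 ->
  is_derive (fun y => plackett (a y) (b y) (r y)) x
    (conditional_cdf (a x) (b x) (r x) * da x + conditional_cdf (b x) (a x) (r x) * db x
     + binormal_pdf (a x) (b x) (r x) * dr x).
Proof.
  intros Hloc Hda Hdb Hdr Hrx.
  destruct (locally_singleton _ _ Hloc) as [Ha [Hb Hr]].
  assert (Ca : continuous a x) by (apply (ex_derive_continuous a); eexists; apply Ha).
  assert (Cb : continuous b x) by (apply (ex_derive_continuous b); eexists; apply Hb).
  assert (Cr : continuous r x) by (apply (ex_derive_continuous r); eexists; apply Hr).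
  (* The partial derivative of the integrand in the parameter, made explicit because its joint
     continuity in [y] and [u] must be checked. *)
  set (D := fun y u => dr y * binormal_pdf (a y) (b y) (r y * u) +
    r y * (binormal_pdf (a y) (b y) (r y * u)
     * ((r y * u * b y - a y) / (1 - (r y * u) ^ 2) * da y
        + (r y * u * a y - b y) / (1 - (r y * u) ^ 2) * db y
        + (r y * u / (1 - (r y * u) ^ 2) + a y * b y / (1 - (r y * u) ^ 2)
           - r y * u * (a y ^ 2 - 2 * (r y * u) * a y * b y + b y ^ 2)
             / (1 - (r y * u) ^ 2) ^ 2) * (dr y * u)))).
  assert (HD : forall y u, is_derive a y (da y) -> is_derive b y (db y) ->
    is_derive r y (dr y) -> -1 < r y * u < 1 ->
    is_derive (fun z => r z * binormal_pdf (a z) (b z) (r z * u)) y (D y u)).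
  { intros y u H1 H2 H3 H4.
    assert (Hru : is_derive (fun z => r z * u) y (dr y * u)).
    { auto_derive; [eexists; exact H3 |].
      rewrite (is_derive_unique (fun x : R => r x) _ _ H3); ring. }
    assert (H5 := is_derive_binormal_pdf a b (fun z => r z * u) y _ _ _ H1 H2 Hru H4).
    apply (is_derive_mult r (fun z => binormal_pdf (a z) (b z) (r z * u)) y
             _ _ H3 H5 Rmult_comm). }
  assert (HI : is_derive (fun y => RInt (fun u => r y * binormal_pdf (a y) (b y) (r y * u)) 0 1)
    x (conditional_cdf (a x) (b x) (r x) * da x + conditional_cdf (b x) (a x) (r x) * db x
       + binormal_pdf (a x) (b x) (r x) * dr x
       - (normal_pdf (a x) * Nstd (b x) * da x + normal_pdf (b x) * Nstd (a x) * db x))).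
  { assert (Hr1 : locally x (fun y => -1 < r y < 1)).
    { apply (Cr (fun z => -1 < z < 1)).
      apply (locally_interval _ (r x) (-1) 1); simpl; intros; lra. }
    (* The formula [D] is valid only while the correlation stays inside (-1, 1), and this is needed
       on a two-dimensional neighbourhood. *)
    assert (H2d : forall t, 0 <= t <= 1 -> locally_2d (fun u v => -1 < r u * v < 1) x t).
    { intros t Ht; assert (Hxt := mul_unit_interval _ _ Hrx Ht).
      assert (Hc : continuity_2d_pt (fun u v => r u * v) x t).
      { apply continuity_2d_pt_mult;
          [apply continuity_2d_pt_proj1, Cr | apply continuity_2d_pt_id2]. }
      apply continuity_2d_pt_filterlim in Hc.
      apply locally_2d_locally.
      apply (Hc (fun z => -1 < z < 1)).
      apply (locally_interval _ (r x * t) (-1) 1); simpl; intros; lra. }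
    evar_last.
    { apply (is_derive_RInt_param
        (fun y u => r y * binormal_pdf (a y) (b y) (r y * u)) 0 1 x).
      - rewrite Rmin_left, Rmax_right by lra.
        generalize (filter_and _ _ Hloc Hr1); apply filter_imp.
        intros y [[H1 [H2 H3]] H4] t Ht; exists (D y t).
        apply HD; try assumption; apply mul_unit_interval; assumption.
      - rewrite Rmin_left, Rmax_right by lra; intros t Ht.
        apply continuity_2d_pt_ext_loc with D.
        + generalize (locally_2d_and _ _ _ _ (locally_2d_proj1 _ x t Hloc) (H2d t Ht)).
          apply locally_2d_impl, locally_2d_forall; intros u v [[H1 [H2 H3]] H4].
          symmetry; apply is_derive_unique, HD; assumption.
        + assert (Hxt := mul_unit_interval _ _ Hrx Ht).
          assert (Hp := one_minus_sqr_pos _ Hxt).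
          assert (Hs := sqrt_one_minus_sqr_pos _ Hxt); assert (HP := PI_RGT_0).
          assert (C1 : continuity_2d_pt (fun u v => r u * v) x t).
          { apply continuity_2d_pt_mult;
              [apply continuity_2d_pt_proj1, Cr | apply continuity_2d_pt_id2]. }
          assert (Cpow : forall f n, continuity_2d_pt f x t ->
                    continuity_2d_pt (fun u v => f u v ^ n) x t).
          { intros f n Hf; induction n; simpl;
              [apply continuity_2d_pt_const | apply continuity_2d_pt_mult; assumption]. }
          assert (C2 : continuity_2d_pt (fun u v => 1 - (r u * v) ^ 2) x t).
          { apply continuity_2d_pt_minus; [apply continuity_2d_pt_const |].
            apply (Cpow (fun u v => r u * v)), C1. }
          assert (C3 : continuity_2d_pt (fun u v => / (1 - (r u * v) ^ 2)) x t).
          { apply continuity_2d_pt_inv; [exact C2 | lra]. }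
          assert (C4 : continuity_2d_pt (fun u v => / (1 - (r u * v) ^ 2) ^ 2) x t).
          { apply (continuity_2d_pt_inv (fun u v => (1 - (r u * v) ^ 2) ^ 2)).
            - apply (Cpow (fun u v => 1 - (r u * v) ^ 2)), C2.
            - apply pow_nonzero; lra. }
          assert (Ca2 := continuity_2d_pt_proj1 a x t Ca).
          assert (Cb2 := continuity_2d_pt_proj1 b x t Cb).
          assert (Cr2 := continuity_2d_pt_proj1 r x t Cr).
          assert (Cda2 := continuity_2d_pt_proj1 da x t Hda).
          assert (Cdb2 := continuity_2d_pt_proj1 db x t Hdb).
          assert (Cdr2 := continuity_2d_pt_proj1 dr x t Hdr).
          assert (Cv := continuity_2d_pt_id2 x t).
          assert (Cpdf : continuity_2d_pt
                    (fun u v => binormal_pdf (a u) (b u) (r u * v)) x t).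
          { unfold binormal_pdf, Rdiv; apply continuity_2d_pt_mult.
            - apply (continuity_1d_2d_pt_comp exp).
              { apply derivable_continuous_pt, derivable_pt_exp. }
              apply continuity_2d_pt_mult.
              + apply (continuity_2d_pt_opp
                  (fun u v => a u ^ 2 - 2 * (r u * v) * a u * b u + b u ^ 2)).
                apply continuity_2d_pt_plus;
                  [apply continuity_2d_pt_minus | apply (Cpow (fun u _ => b u)), Cb2].
                * apply (Cpow (fun u _ => a u)), Ca2.
                * repeat (assumption || apply continuity_2d_pt_mult
                          || apply continuity_2d_pt_const).
              + apply continuity_2d_pt_inv; [| apply Rgt_not_eq; nra].
                apply continuity_2d_pt_mult; [apply continuity_2d_pt_const | exact C2].
            - apply continuity_2d_pt_inv; [| apply Rgt_not_eq; nra].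
              apply continuity_2d_pt_mult; [apply continuity_2d_pt_const |].
              apply (continuity_1d_2d_pt_comp sqrt); [| exact C2].
              apply continuity_pt_sqrt; lra. }
          unfold D, Rdiv.
          repeat (assumption || apply continuity_2d_pt_mult
                  || apply continuity_2d_pt_plus || apply continuity_2d_pt_opp
                  || apply continuity_2d_pt_const
                  || apply (Cpow (fun u _ => a u)) || apply (Cpow (fun u _ => b u))).
      - generalize Hr1; apply filter_imp; intros y Hy.
        apply ex_RInt_binormal_pdf_corr, Hy. }
    apply is_RInt_unique.
    (* [M] is a primitive of [D x] in [u]: the first two terms by the coincidence of the derivatives
       in bound and correlation, the last by the product rule. [M 1] is the desired derivative, and
       [M 0], at correlation 0, is the derivative of [Nstd a * Nstd b]. *)
    set (M := fun u => conditional_cdf (a x) (b x) (r x * u) * da x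
       + conditional_cdf (b x) (a x) (r x * u) * db x
       + u * binormal_pdf (a x) (b x) (r x * u) * dr x).
    replace (_ - _) with (minus (M 1) (M 0)).
    - apply (is_RInt_ext (D x)).
      { intros u Hu; rewrite Rmin_left, Rmax_right in Hu by lra.
        symmetry; apply is_derive_unique, HD; try assumption.
        apply mul_unit_interval; [assumption | lra]. }
      apply (is_RInt_derive M (D x)); rewrite Rmin_left, Rmax_right by lra.
      + intros u Hu; assert (H := mul_unit_interval _ _ Hrx Hu).
        assert (Hp := one_minus_sqr_pos _ H).
        assert (Hru : is_derive (fun u => r x * u) u (r x)) by (auto_derive; [trivial | ring]).
        assert (H1 := is_derive_comp (conditional_cdf (a x) (b x)) _ u _ _
                 (is_derive_conditional_cdf_corr _ _ _ H) Hru).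
        assert (H2 := is_derive_comp (conditional_cdf (b x) (a x)) _ u _ _
                 (is_derive_conditional_cdf_corr _ _ _ H) Hru).
        assert (H3 := is_derive_binormal_pdf (fun _ => a x) (fun _ => b x) _ u 0 0 _
                 (is_derive_const (a x) u) (is_derive_const (b x) u) Hru H).
        unfold M.
        set (f1 := fun u => conditional_cdf (a x) (b x) (r x * u)) in *.
        set (f2 := fun u => conditional_cdf (b x) (a x) (r x * u)) in *.
        set (f3 := fun u => binormal_pdf (a x) (b x) (r x * u)) in *.
        apply (is_derive_ext (fun u => f1 u * da x + f2 u * db x + u * f3 u * dr x));
          [reflexivity |].
        auto_derive.
        * repeat split; eexists; eassumption.
        * rewrite (is_derive_unique (fun x : R => f1 x) _ _ H1).
          rewrite (is_derive_unique (fun x : R => f2 x) _ _ H2).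
          rewrite (is_derive_unique (fun x : R => f3 x) _ _ H3).
          unfold f3, D, scal; simpl; unfold mult; simpl.
          rewrite (binormal_pdf_sym (b x) (a x)); simpl in Hp; field; lra.
      + intros u Hu; assert (H := mul_unit_interval _ _ Hrx Hu).
        assert (Hp := one_minus_sqr_pos _ H).
        assert (H3 : ex_derive (fun u => binormal_pdf (a x) (b x) (r x * u)) u).
        { eexists; apply (is_derive_binormal_pdf (fun _ => a x) (fun _ => b x)
            (fun u => r x * u) u 0 0 (r x));
            [apply (is_derive_const (a x)) | apply (is_derive_const (b x)) | | exact H].
          auto_derive; [trivial | ring]. }
        apply (ex_derive_continuous (D x)).
        unfold D; set (f3 := fun u => binormal_pdf (a x) (b x) (r x * u)) in *.
        apply (ex_derive_ext (fun u => dr x * f3 u +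
          r x * (f3 u
           * ((r x * u * b x - a x) / (1 - (r x * u) ^ 2) * da x
              + (r x * u * a x - b x) / (1 - (r x * u) ^ 2) * db x
              + (r x * u / (1 - (r x * u) ^ 2) + a x * b x / (1 - (r x * u) ^ 2)
                 - r x * u * (a x ^ 2 - 2 * (r x * u) * a x * b x + b x ^ 2)
                   / (1 - (r x * u) ^ 2) ^ 2) * (dr x * u))))); [reflexivity |].
        simpl in Hp; auto_derive; repeat split; try exact H3; try lra.
        apply Rgt_not_eq; nra.
    - unfold M, conditional_cdf.
      change minus with Rminus; simpl.
      rewrite !Rmult_1_r, !Rmult_0_r, !Rminus_0_r, sqrt_1, !Rmult_0_l, !Rminus_0_r, !Rdiv_1_r.
      ring. }
  (* The product rule for [Nstd a * Nstd b] restores exactly the terms subtracted in [HI]. *)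
  assert (H1 := is_derive_comp Nstd _ x _ _ (is_derive_Nstd _) Ha).
  assert (H2 := is_derive_comp Nstd _ x _ _ (is_derive_Nstd _) Hb).
  assert (H12 := is_derive_mult _ _ x _ _ H1 H2 Rmult_comm).
  evar_last; [exact (is_derive_plus _ _ x _ _ H12 HI) |].
  unfold scal, plus; simpl; unfold mult; simpl; ring.
Qed.

(** * Bounds and limits at infinity *)

Lemma gauss_le_1 (x : R) : gauss x <= 1.
Proof.
  apply Rle_trans with (1 := gauss_le_inv x).
  assert (0 <= x ^ 2) by apply pow2_ge_0.
  apply Rmult_le_reg_r with (2 + x ^ 2); [lra |].
  unfold Rdiv; rewrite Rmult_assoc, Rinv_l; lra.
Qed.

Lemma binormal_pdf_bounds (a b t : R) : -1 < t < 1 ->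
  0 <= binormal_pdf a b t <= gauss a / (2 * PI * sqrt (1 - t ^ 2)).
Proof.
  intros H; rewrite binormal_pdf_factor by exact H.
  assert (Hs := sqrt_one_minus_sqr_pos _ H).
  assert (HP := PI_RGT_0); assert (H2 := sqrt_2PI_pos).
  unfold normal_pdf; set (u := (b - t * a) / _).
  assert (Hu := gauss_le_1 u); assert (Hu' := gauss_pos u); assert (Ha := gauss_pos a).
  replace (/ sqrt (2 * PI) * gauss a * (/ sqrt (2 * PI) * gauss u) / sqrt (1 - t ^ 2))
    with (gauss a * gauss u / (2 * PI * sqrt (1 - t ^ 2)))
    by (rewrite <- (sqrt_sqrt (2 * PI)) at 1 by lra; field; lra).
  assert (0 < / (2 * PI * sqrt (1 - t ^ 2))) by (apply Rinv_0_lt_compat; nra).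
  unfold Rdiv; split.
  - apply Rmult_le_pos; nra.
  - apply Rmult_le_compat_r; nra.
Qed.

(** The conditional Gaussian factor is bounded by 1, so [b] disappears from the estimate. The factor
    [gauss a] gives the limit at minus infinity in [a]; uniformity in [b] serves the limit of
    vanishing time, where [b] diverges. *)
Lemma plackett_bound (a b r : R) : -1 < r < 1 ->
  Rabs (plackett a b r - Nstd a * Nstd b)
  <= Rabs r / (2 * PI * sqrt (1 - r ^ 2)) * gauss a.
Proof.
  intros H; unfold plackett.
  rewrite Rplus_minus_l.
  replace (Rabs r / (2 * PI * sqrt (1 - r ^ 2)) * gauss a)
    with ((1 - 0) * (Rabs r / (2 * PI * sqrt (1 - r ^ 2)) * gauss a)) by ring.
  apply abs_RInt_le_const; [lra | apply ex_RInt_binormal_pdf_corr, H |].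
  intros u Hu; assert (Hru := mul_unit_interval _ _ H Hu).
  assert (Hs := sqrt_one_minus_sqr_pos _ H); assert (HP := PI_RGT_0).
  rewrite Rabs_mult; unfold Rdiv; rewrite Rmult_assoc.
  apply Rmult_le_compat_l; [apply Rabs_pos |].
  destruct (binormal_pdf_bounds a b _ Hru) as [H1 H2].
  rewrite Rabs_pos_eq by exact H1.
  apply Rle_trans with (1 := H2); rewrite (Rmult_comm (/ _)).
  assert (Ha := gauss_pos a).
  apply Rmult_le_compat_l; [lra |].
  (* Since [u] lies in the unit interval, the root at [r * u] is at least the root at [r]. *)
  apply Rinv_le_contravar; [nra |].
  apply Rmult_le_compat_l; [lra |].
  apply sqrt_le_1_alt.
  assert (0 <= r ^ 2) by apply pow2_ge_0; assert (u ^ 2 <= 1) by nra.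
  rewrite Rpow_mult_distr; nra.
Qed.

Lemma is_lim_plackett_m (b r : R) : -1 < r < 1 ->
  is_lim (fun a => plackett a b r) m_infty 0.
Proof.
  intros H; set (c := Rabs r / (2 * PI * sqrt (1 - r ^ 2))).
  assert (Hg : is_lim gauss m_infty 0).
  { apply (is_lim_ext (fun x => gauss (- x))).
    { intros; unfold gauss; do 3 f_equal; ring. }
    apply (is_lim_comp gauss (fun x => - x) m_infty 0 p_infty).
    - apply is_lim_gauss_p.
    - apply (is_lim_opp (fun x => x) m_infty m_infty), is_lim_id.
    - exists 0; intros; discriminate. }
  assert (HN : is_lim (fun a => Nstd b * Nstd a) m_infty 0).
  { replace (Finite 0) with (Rbar_mult (Nstd b) 0) by (simpl; f_equal; ring).
    apply (is_lim_scal_l Nstd), is_lim_Nstd_m. }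
  assert (Hc : is_lim (fun a => c * gauss a) m_infty 0).
  { replace (Finite 0) with (Rbar_mult c 0) by (simpl; f_equal; ring).
    apply (is_lim_scal_l gauss), Hg. }
  apply (is_lim_le_le_loc (fun a => Nstd b * Nstd a - c * gauss a)
           (fun a => Nstd b * Nstd a + c * gauss a)).
  - exists 0; intros a _; assert (Hb := plackett_bound a b r H).
    apply Rabs_le_between in Hb; fold c in Hb; lra.
  - replace (Finite 0) with (Finite (0 - 0)) by (f_equal; ring).
    apply is_lim_minus'; assumption.
  - replace (Finite 0) with (Finite (0 + 0)) by (f_equal; ring).
    apply is_lim_plus'; assumption.
Qed.

Lemma is_lim_affine_p (c s : R) : 0 < s ->
  is_lim (fun y => (y - c) / s) p_infty p_infty.
Proof.
  intros Hs P [M HM]; exists (M * s + c); intros y Hy; apply HM.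
  apply Rmult_lt_reg_r with s; [exact Hs |].
  unfold Rdiv; rewrite Rmult_assoc, Rinv_l; lra.
Qed.

Lemma is_lim_affine_m (c s : R) : 0 < s ->
  is_lim (fun y => (y - c) / s) m_infty m_infty.
Proof.
  intros Hs P [M HM]; exists (M * s + c); intros y Hy; apply HM.
  apply Rmult_lt_reg_r with s; [exact Hs |].
  unfold Rdiv; rewrite Rmult_assoc, Rinv_l; lra.
Qed.

Lemma is_lim_conditional_cdf (a t : R) : -1 < t < 1 ->
  is_lim (fun b => conditional_cdf a b t) m_infty 0 /\
  is_lim (fun b => conditional_cdf a b t) p_infty (normal_pdf a).
Proof.
  intros H; assert (Hs := sqrt_one_minus_sqr_pos _ H); unfold conditional_cdf; split.
  - replace (Finite 0) with (Rbar_mult (normal_pdf a) 0) by (simpl; f_equal; ring).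
    apply (is_lim_scal_l (fun b => Nstd ((b - t * a) / sqrt (1 - t ^ 2)))).
    apply (is_lim_comp Nstd _ m_infty 0 m_infty).
    + apply is_lim_Nstd_m.
    + apply is_lim_affine_m, Hs.
    + exists 0; intros; discriminate.
  - replace (Finite (normal_pdf a)) with (Rbar_mult (normal_pdf a) 1)
      by (simpl; f_equal; ring).
    apply (is_lim_scal_l (fun b => Nstd ((b - t * a) / sqrt (1 - t ^ 2)))).
    apply (is_lim_comp Nstd _ p_infty 1 p_infty).
    + apply is_lim_Nstd_p.
    + apply is_lim_affine_p, Hs.
    + exists 0; intros; discriminate.
Qed.

(** * Evaluation of the improper double integral *)

(** The derivative of [conditional_cdf] in its second argument is the density, so it is a primitive
    up to the normalising constant, and it vanishes at minus infinity. The filter [F] covers both a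
    finite and an infinite strike bound. *)
Lemma RInt_gen_binormal_inner (y1 t : R) (F : (R -> Prop) -> Prop)
  {FF : ProperFilter F} (l : R) : -1 < t < 1 ->
  filterlim (fun b => conditional_cdf y1 b t) F (locally l) ->
  RInt_gen (fun y2 => exp (- (y1 ^ 2 - 2 * t * y1 * y2 + y2 ^ 2) / (2 * (1 - t ^ 2))))
    (Rbar_locally m_infty) F = 2 * PI * sqrt (1 - t ^ 2) * l.
Proof.
  intros H Hl; set (c := 2 * PI * sqrt (1 - t ^ 2)).
  assert (Hs := sqrt_one_minus_sqr_pos _ H); assert (HP := PI_RGT_0).
  assert (Hc : 0 < c) by (unfold c; nra).
  rewrite (RInt_gen_primitive (fun y2 => c * conditional_cdf y1 y2 t)
    (fun y2 => exp (- (y1 ^ 2 - 2 * t * y1 * y2 + y2 ^ 2) / (2 * (1 - t ^ 2))))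
    (Rbar_locally m_infty) F (c * 0) (c * l)).
  - now rewrite Rmult_0_r, Rminus_0_r.
  - intros y2; evar_last.
    + apply (is_derive_scal (fun y2 => conditional_cdf y1 y2 t)).
      apply is_derive_conditional_cdf_bound, H.
    + unfold binormal_pdf; fold c; field; lra.
  - intros y2.
    apply (ex_derive_continuous
      (fun y2 => exp (- (y1 ^ 2 - 2 * t * y1 * y2 + y2 ^ 2) / (2 * (1 - t ^ 2))))).
    assert (Hp := one_minus_sqr_pos _ H).
    auto_derive; simpl in Hp; repeat split; lra.
  - apply (is_lim_scal_l (fun y2 => conditional_cdf y1 y2 t) c m_infty 0).
    apply is_lim_conditional_cdf, H.
  - eapply filterlim_comp; [exact Hl |].
    apply (filterlim_scal_r (K := R_AbsRing) (V := R_NormedModule) c l).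
Qed.

Lemma continuous_normal_pdf (x : R) : continuous normal_pdf x.
Proof.
  apply (continuous_scal_r (/ sqrt (2 * PI)) gauss), continuous_gauss.
Qed.

Lemma continuous_conditional_cdf (b t x : R) :
  continuous (fun a => conditional_cdf a b t) x.
Proof.
  apply (continuous_mult normal_pdf (fun a => Nstd ((b - t * a) / sqrt (1 - t ^ 2)))).
  - apply continuous_normal_pdf.
  - apply (continuous_comp (fun a => (b - t * a) / sqrt (1 - t ^ 2)) Nstd).
    + apply (ex_derive_continuous (fun a => (b - t * a) / sqrt (1 - t ^ 2))).
      unfold Rdiv; auto_derive; trivial.
    + apply continuous_Nstd.
Qed.

(** With [b] and [r] frozen, [plackett] has derivative [conditional_cdf] in [a] and tends to 0 at
    minus infinity; it is therefore the normalised outer integral, with no interchange of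
    integrations. *)
Lemma N2gen_finite (a b r : R) : -1 < r < 1 -> N2gen a (Finite b) r = plackett a b r.
Proof.
  intros H; assert (Hs := sqrt_one_minus_sqr_pos _ H); assert (HP := PI_RGT_0).
  unfold N2gen, upper_filter.
  set (c := 2 * PI * sqrt (1 - r ^ 2)).
  assert (Hc : 0 < c) by (unfold c; nra).
  replace (fun y1 => RInt_gen _ _ _) with (fun y1 => c * conditional_cdf y1 b r).
  - rewrite (RInt_gen_primitive (fun y => c * plackett y b r)
      (fun y => c * conditional_cdf y b r)
      (Rbar_locally m_infty) (at_point a) (c * 0) (c * plackett a b r)).
    + field; lra.
    + intros y; apply (is_derive_scal (fun y => plackett y b r)).
      evar_last.
      * apply (is_derive_plackett (fun y => y) (fun _ => b) (fun _ => r)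
          (fun _ => 1) (fun _ => 0) (fun _ => 0)); try apply continuous_const; [| exact H].
        apply filter_forall; intros z.
        split; [apply (is_derive_id z) |].
        split; [apply (is_derive_const b z) | apply (is_derive_const r z)].
      * simpl; ring.
    + intros y; apply (continuous_scal_r c (fun y => conditional_cdf y b r)).
      apply continuous_conditional_cdf.
    + apply (is_lim_scal_l (fun y => plackett y b r) c m_infty 0).
      apply is_lim_plackett_m, H.
    + apply (filterlim_at_point (fun y => c * plackett y b r)).
  - apply functional_extensionality; intros y1; symmetry.
    apply RInt_gen_binormal_inner; [apply at_point_filter | exact H |].
    apply (filterlim_at_point (fun b => conditional_cdf y1 b r)).
Qed.

Lemma N2gen_p_infty (a r : R) : -1 < r < 1 -> N2gen a p_infty r = Nstd a.
Proof.
  intros H; assert (Hs := sqrt_one_minus_sqr_pos _ H); assert (HP := PI_RGT_0).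
  unfold N2gen, upper_filter.
  set (c := 2 * PI * sqrt (1 - r ^ 2)).
  assert (Hc : 0 < c) by (unfold c; nra).
  replace (fun y1 => RInt_gen _ _ _) with (fun y1 => c * normal_pdf y1).
  - rewrite (RInt_gen_primitive (fun y => c * Nstd y) (fun y => c * normal_pdf y)
      (Rbar_locally m_infty) (at_point a) (c * 0) (c * Nstd a)).
    + field; lra.
    + intros y; apply (is_derive_scal Nstd), is_derive_Nstd.
    + intros y; apply (continuous_scal_r c normal_pdf), continuous_normal_pdf.
    + apply (is_lim_scal_l Nstd c m_infty 0), is_lim_Nstd_m.
    + apply (filterlim_at_point (fun y => c * Nstd y)).
  - apply functional_extensionality; intros y1; symmetry.
    apply RInt_gen_binormal_inner; [apply Rbar_locally_filter | exact H |].
    apply is_lim_conditional_cdf, H.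
Qed.

(** * Second space derivatives and the reduction to a heat equation *)

Lemma is_derive_normal_pdf (x : R) : is_derive normal_pdf x (- x * normal_pdf x).
Proof.
  evar_last; [apply (is_derive_scal gauss), is_derive_gauss |].
  unfold normal_pdf; simpl; ring.
Qed.

(** Provides the second space derivative of [plackett]; [t] is constant because the correlation
    depends on time alone. *)
Lemma is_derive_conditional_cdf (a b : R -> R) (x da db t : R) :
  is_derive a x da -> is_derive b x db -> -1 < t < 1 ->
  is_derive (fun y => conditional_cdf (a y) (b y) t) x
    (- a x * conditional_cdf (a x) (b x) t * da
     + binormal_pdf (a x) (b x) t * (db - t * da)).
Proof.
  intros Ha Hb H; rewrite binormal_pdf_factor by exact H.
  assert (Hs := sqrt_one_minus_sqr_pos _ H).
  unfold conditional_cdf; set (s := sqrt (1 - t ^ 2)) in *.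
  assert (Hu : is_derive (fun y => (b y - t * a y) / s) x ((db - t * da) / s)).
  { auto_derive.
    - repeat split; eexists; eassumption.
    - rewrite (is_derive_unique (fun x : R => a x) _ _ Ha).
      rewrite (is_derive_unique (fun x : R => b x) _ _ Hb); field; lra. }
  assert (HN := is_derive_comp Nstd _ x _ _ (is_derive_Nstd _) Hu).
  assert (Hp := is_derive_comp normal_pdf _ x _ _ (is_derive_normal_pdf _) Ha).
  evar_last; [exact (is_derive_mult _ _ x _ _ Hp HN Rmult_comm) |].
  unfold scal, plus; simpl; unfold mult; simpl; field; lra.
Qed.

(* With [V = X^beta exp (mu tau) W (ln X, tau)] the Black-Scholes equation
   becomes a constant-coefficient heat equation with drift for [W]. *)
Lemma black_scholes_log_reduction (sigma r q beta : R) (V W : R -> R -> R) (Wx : R -> R)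
  (X tau Wt Wxx : R) :
  (forall Y s, 0 < Y -> 0 < s ->
     V Y s = Rpower Y beta * exp (mu r q sigma beta * s) * W (ln Y) s) ->
  0 < X -> 0 < tau ->
  is_derive (fun s => W (ln X) s) tau Wt ->
  (forall x, is_derive (fun z => W z tau) x (Wx x)) ->
  is_derive Wx (ln X) Wxx ->
  Wt = sigma ^ 2 / 2 * Wxx + (r - q - sigma ^ 2 / 2 + sigma ^ 2 * beta) * Wx (ln X) ->
  exists Vtau VX VXX : R,
    is_derive (fun s => V X s) tau Vtau /\
    (forall Y, 0 < Y -> ex_derive (fun Z => V Z tau) Y) /\
    is_derive (fun Y => V Y tau) X VX /\
    is_derive (fun Y => Derive (fun Z => V Z tau) Y) X VXX /\
    - Vtau + / 2 * sigma ^ 2 * X ^ 2 * VXX + (r - q) * X * VX - r * V X tau = 0.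
Proof.
  intros HV HX Htau HWt HWx HWxx Hheat.
  set (e := exp (mu r q sigma beta * tau)).
  assert (Hpos : forall Y, 0 < Y -> locally Y (fun Z => 0 < Z)).
  { intros Y HY; apply (locally_interval _ Y 0 p_infty); simpl; auto. }
  set (VX := fun Y => Rpower Y beta * e * (beta * W (ln Y) tau + Wx (ln Y)) / Y).
  assert (HVX : forall Y, 0 < Y -> is_derive (fun Z => V Z tau) Y (VX Y)).
  { intros Y HY; set (f := fun z => W z tau) in *.
    apply (is_derive_ext_loc (fun Z => exp (beta * ln Z) * e * f (ln Z))).
    - generalize (Hpos Y HY); apply filter_imp; intros Z HZ.
      now rewrite HV by assumption.
    - assert (Hf := HWx (ln Y)); auto_derive.
      + repeat split; [assumption | eexists; exact Hf | assumption].
      + rewrite (is_derive_unique (fun x : R => f x) _ _ Hf).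
        unfold VX, Rpower; fold (f (ln Y)); field; lra. }
  (* Behind the prefactor, [X d/dX] acts as [beta + d/dx], and [X^2 d^2/dX^2] as
     [(beta + d/dx)^2 - (beta + d/dx)], which yields the coefficients [beta (beta - 1)] and
     [2 beta - 1]. *)
  exists (Rpower X beta * e * (mu r q sigma beta * W (ln X) tau + Wt)), (VX X),
    (Rpower X beta * e * (beta * (beta - 1) * W (ln X) tau
       + (2 * beta - 1) * Wx (ln X) + Wxx) / X ^ 2).
  split; [| split; [| split; [| split]]].
  - set (f := fun s => W (ln X) s) in *.
    apply (is_derive_ext_loc (fun s => Rpower X beta * exp (mu r q sigma beta * s) * f s)).
    + generalize (Hpos tau Htau); apply filter_imp; intros s Hs.
      now rewrite HV by assumption.
    + auto_derive; [eexists; exact HWt |].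
      rewrite (is_derive_unique (fun x : R => f x) _ _ HWt).
      fold e; unfold f; ring.
  - intros Y HY; exists (VX Y); apply HVX, HY.
  - apply HVX, HX.
  - apply (is_derive_ext_loc VX).
    { generalize (Hpos X HX); apply filter_imp; intros Z HZ.
      symmetry; apply is_derive_unique, HVX, HZ. }
    set (f := fun z => W z tau) in *; assert (Hf := HWx (ln X)).
    apply (is_derive_ext (fun Y => exp (beta * ln Y) * e * (beta * f (ln Y) + Wx (ln Y)) / Y));
      [reflexivity |].
    auto_derive.
    + repeat split; try assumption; try (eexists; eassumption); lra.
    + rewrite (is_derive_unique (fun x : R => f x) _ _ Hf).
      rewrite (is_derive_unique (fun x : R => Wx x) _ _ HWxx).
      unfold Rpower, f; field; lra.
  (* The terms in [W] cancel because [mu] equals [sigma^2 / 2 * beta (beta - 1) + (r - q) beta - r];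
     those in [Wx] cancel through the drift. *)
  - rewrite HV by assumption; fold e; rewrite Hheat; unfold VX, mu; field; lra.
Qed.

(** * The two bounds and the correlation in logarithmic variables *)

Definition drift (r q sigma beta : R) : R := r - q - sigma ^ 2 / 2 + sigma ^ 2 * beta.

Definition shift (r q sigma L t1 t2 : R) : R :=
  - ln L + (r - q - sigma ^ 2 / 2) * t1 + sigma ^ 2 * t2.

(** Both bounds depend on [x] and [s] in their numerators only through [x + m * s], with the same
    drift [m]; [c] gathers what is independent of price and time. *)
Definition log_a1 (sigma m c i t3 x s : R) : R :=
  (i * (x + m * s) + c) / (sigma * sqrt (t3 + i ^ 2 * s)).

Definition log_a2 (sigma m k x s : R) : R := (x + m * s - k) / (sigma * sqrt s).

Definition corr (i t3 s : R) : R := i * (sqrt s / sqrt (t3 + i ^ 2 * s)).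

Lemma variance_pos (i t3 s : R) : 0 < t3 -> 0 <= s -> 0 < t3 + i ^ 2 * s.
Proof. intros; assert (0 <= i ^ 2) by apply pow2_ge_0; nra. Qed.

(** Strictness comes from [0 < t3], since the squared correlation is [i^2 s / (t3 + i^2 s)]; the
    density never degenerates. *)
Lemma corr_bounds (i t3 s : R) : 0 < t3 -> 0 <= s -> -1 < corr i t3 s < 1.
Proof.
  intros H3 Hs; assert (Hp := variance_pos i t3 s H3 Hs); unfold corr.
  assert (HD := sqrt_lt_R0 _ Hp).
  assert (HDD := pow2_sqrt _ (Rlt_le _ _ Hp)); assert (HSS := pow2_sqrt _ Hs).
  set (D := sqrt (t3 + i ^ 2 * s)) in *; set (S := sqrt s) in *.
  assert (H : (i * (S / D)) ^ 2 < 1).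
  { apply Rmult_lt_reg_r with (D ^ 2); [nra |].
    replace ((i * (S / D)) ^ 2 * D ^ 2) with (i ^ 2 * S ^ 2) by (field; lra).
    rewrite HDD, HSS; lra. }
  nra.
Qed.

Lemma delta_a1 (r q sigma beta i L t1 t2 t3 X s : R) : 0 < L -> 0 < X ->
  delta r q sigma (Rpower X i / L) (t1 + i * s) (t2 + i * beta * s) (t3 + i ^ 2 * s)
  = log_a1 sigma (drift r q sigma beta) (shift r q sigma L t1 t2) i t3 (ln X) s.
Proof.
  intros HL HX; unfold delta, log_a1, drift, shift.
  rewrite ln_div by (assumption || apply exp_pos); unfold Rpower; rewrite ln_exp.
  f_equal; ring.
Qed.

Lemma delta_a2 (r q sigma beta K X s : R) : 0 < K -> 0 < X ->
  delta r q sigma (X / K) s (beta * s) s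
  = log_a2 sigma (drift r q sigma beta) (ln K) (ln X) s.
Proof.
  intros HK HX; unfold delta, log_a2, drift.
  rewrite ln_div by assumption; f_equal; ring.
Qed.

Lemma Vsol_zero_strike (r q sigma beta i L t1 t2 t3 X s : R) :
  0 < L -> 0 < t3 -> 0 < X -> 0 < s ->
  Vsol r q sigma beta i L 0 t1 t2 t3 X s
  = Rpower X beta * exp (mu r q sigma beta * s)
    * Nstd (log_a1 sigma (drift r q sigma beta) (shift r q sigma L t1 t2) i t3 (ln X) s).
Proof.
  intros HL H3 HX Hs; unfold Vsol.
  destruct (Req_EM_T 0 0) as [_ | E]; [| now elim E].
  assert (Hp := variance_pos i t3 s H3 (Rlt_le _ _ Hs)).
  rewrite sqrt_div by lra; fold (corr i t3 s).
  rewrite N2gen_p_infty by (apply corr_bounds; lra).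
  now rewrite (delta_a1 r q sigma beta) by assumption.
Qed.

Lemma Vsol_pos_strike (r q sigma beta i L K t1 t2 t3 X s : R) :
  0 < L -> 0 < K -> 0 < t3 -> 0 < X -> 0 < s ->
  Vsol r q sigma beta i L K t1 t2 t3 X s
  = Rpower X beta * exp (mu r q sigma beta * s)
    * plackett
        (log_a1 sigma (drift r q sigma beta) (shift r q sigma L t1 t2) i t3 (ln X) s)
        (log_a2 sigma (drift r q sigma beta) (ln K) (ln X) s) (corr i t3 s).
Proof.
  intros HL HK H3 HX Hs; unfold Vsol.
  destruct (Req_EM_T K 0) as [E | _]; [lra |].
  assert (Hp := variance_pos i t3 s H3 (Rlt_le _ _ Hs)).
  rewrite sqrt_div by lra; fold (corr i t3 s).
  rewrite N2gen_finite by (apply corr_bounds; lra).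
  now rewrite (delta_a1 r q sigma beta), (delta_a2 r q sigma beta) by assumption.
Qed.

(** The derivative is expressed through [log_a1] itself, which lets the heat equation be checked
    later with the bounds as free letters. *)
Lemma is_derive_log_a1_time (sigma m c i t3 x s : R) :
  0 < sigma -> 0 < t3 -> 0 < s ->
  is_derive (log_a1 sigma m c i t3 x) s
    (i * m / (sigma * sqrt (t3 + i ^ 2 * s))
     - log_a1 sigma m c i t3 x s * i ^ 2 / (2 * (t3 + i ^ 2 * s))).
Proof.
  intros Hsig H3 Hs; assert (Hp := variance_pos i t3 s H3 (Rlt_le _ _ Hs)).
  assert (HD := sqrt_lt_R0 _ Hp); assert (HDD := pow2_sqrt _ (Rlt_le _ _ Hp)).
  unfold log_a1; auto_derive.
  - simpl in *; repeat split; [lra |]; apply Rgt_not_eq, Rmult_lt_0_compat; lra.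
  - change (t3 + i * (i * 1) * s) with (t3 + i ^ 2 * s) in *.
    set (D := sqrt (t3 + i ^ 2 * s)) in *; rewrite <- HDD; field; lra.
Qed.

Lemma is_derive_log_a2_time (sigma m k x s : R) : 0 < sigma -> 0 < s ->
  is_derive (log_a2 sigma m k x) s
    (m / (sigma * sqrt s) - log_a2 sigma m k x s / (2 * s)).
Proof.
  intros Hsig Hs; assert (HS := sqrt_lt_R0 _ Hs).
  assert (HSS := pow2_sqrt _ (Rlt_le _ _ Hs)).
  unfold log_a2; auto_derive.
  - repeat split; [lra |]; apply Rgt_not_eq, Rmult_lt_0_compat; lra.
  - set (S := sqrt s) in *; rewrite <- HSS; field; lra.
Qed.

Lemma is_derive_corr (i t3 s : R) : 0 < t3 -> 0 < s ->
  is_derive (corr i t3) s (i * t3 / (2 * sqrt s * sqrt (t3 + i ^ 2 * s) ^ 3)).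
Proof.
  intros H3 Hs; assert (Hp := variance_pos i t3 s H3 (Rlt_le _ _ Hs)).
  assert (HD := sqrt_lt_R0 _ Hp); assert (HDD := pow2_sqrt _ (Rlt_le _ _ Hp)).
  assert (HS := sqrt_lt_R0 _ Hs); assert (HSS := pow2_sqrt _ (Rlt_le _ _ Hs)).
  unfold corr; auto_derive.
  - simpl in *; repeat split; try lra; apply Rgt_not_eq; lra.
  - change (t3 + i * (i * 1) * s) with (t3 + i ^ 2 * s) in *.
    set (D := sqrt (t3 + i ^ 2 * s)) in *; set (S := sqrt s) in *.
    (* Eliminating [t3] in favour of the two roots makes the identity rational. *)
    replace t3 with (D ^ 2 - i ^ 2 * S ^ 2) by (rewrite HDD, HSS; ring).
    field; lra.
Qed.

Lemma is_derive_log_a1_space (sigma m c i t3 x s : R) :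
  0 < sigma -> 0 < t3 -> 0 < s ->
  is_derive (fun z => log_a1 sigma m c i t3 z s) x (i / (sigma * sqrt (t3 + i ^ 2 * s))).
Proof.
  intros Hsig H3 Hs; assert (Hp := variance_pos i t3 s H3 (Rlt_le _ _ Hs)).
  assert (HD := sqrt_lt_R0 _ Hp).
  unfold log_a1; set (D := sqrt (t3 + i ^ 2 * s)) in *.
  auto_derive; [trivial | field; lra].
Qed.

Lemma is_derive_log_a2_space (sigma m k x s : R) : 0 < sigma -> 0 < s ->
  is_derive (fun z => log_a2 sigma m k z s) x (/ (sigma * sqrt s)).
Proof.
  intros Hsig Hs; assert (HS := sqrt_lt_R0 _ Hs).
  unfold log_a2; set (S := sqrt s) in *; auto_derive; [trivial | field; lra].
Qed.

(** * The heat equation with drift *)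

(** With [p = i / (sigma D)], the drift part of the time derivative is [m p], and the rest,
    [- a i^2 / (2 D^2)], is [sigma^2 / 2 * p^2 * (- a)], matching the second derivative. *)
Lemma heat_equation_Nstd (sigma m c i t3 x s : R) :
  0 < sigma -> 0 < t3 -> 0 < s ->
  let W := fun z u => Nstd (log_a1 sigma m c i t3 z u) in
  exists (Wx : R -> R) (Wt Wxx : R),
    is_derive (fun u => W x u) s Wt /\
    (forall z, is_derive (fun y => W y s) z (Wx z)) /\
    is_derive Wx x Wxx /\
    Wt = sigma ^ 2 / 2 * Wxx + m * Wx x.
Proof.
  intros Hsig H3 Hs W.
  assert (Hp := variance_pos i t3 s H3 (Rlt_le _ _ Hs)).
  assert (HD := sqrt_lt_R0 _ Hp); assert (HDD := pow2_sqrt _ (Rlt_le _ _ Hp)).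
  set (D := sqrt (t3 + i ^ 2 * s)) in *.
  set (a := fun z => log_a1 sigma m c i t3 z s).
  set (p := i / (sigma * D)).
  assert (Ha : forall z, is_derive a z p)
    by (intros; apply is_derive_log_a1_space; assumption).
  exists (fun z => p * normal_pdf (a z)),
    ((i * m / (sigma * D) - a x * i ^ 2 / (2 * (t3 + i ^ 2 * s))) * normal_pdf (a x)),
    (p * (p * (- a x * normal_pdf (a x)))).
  split; [| split; [| split]].
  - apply (is_derive_comp Nstd (log_a1 sigma m c i t3 x)); [apply is_derive_Nstd |].
    apply is_derive_log_a1_time; assumption.
  - intros z; apply (is_derive_comp Nstd a); [apply is_derive_Nstd | apply Ha].
  - apply (is_derive_scal (fun z => normal_pdf (a z))).
    apply (is_derive_comp normal_pdf a); [apply is_derive_normal_pdf | apply Ha].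
  - rewrite <- HDD; unfold p; field; lra.
Qed.

(** Let [p] and [o] be the slopes of the bounds in [x]. The density enters the diffusion term with
    coefficient [sigma^2 / 2 * (2 p o - t (p^2 + o^2))], which equals [i t3 / (2 S D^3)], the time
    derivative of the correlation. *)
Lemma heat_equation_plackett (sigma m c k i t3 x s : R) :
  0 < sigma -> 0 < t3 -> 0 < s ->
  let W := fun z u => plackett (log_a1 sigma m c i t3 z u) (log_a2 sigma m k z u)
                        (corr i t3 u) in
  exists (Wx : R -> R) (Wt Wxx : R),
    is_derive (fun u => W x u) s Wt /\
    (forall z, is_derive (fun y => W y s) z (Wx z)) /\
    is_derive Wx x Wxx /\
    Wt = sigma ^ 2 / 2 * Wxx + m * Wx x.
Proof.
  intros Hsig H3 Hs W.
  assert (Hp := variance_pos i t3 s H3 (Rlt_le _ _ Hs)).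
  assert (HD := sqrt_lt_R0 _ Hp); assert (HDD := pow2_sqrt _ (Rlt_le _ _ Hp)).
  assert (HS := sqrt_lt_R0 _ Hs); assert (HSS := pow2_sqrt _ (Rlt_le _ _ Hs)).
  assert (Hr := corr_bounds i t3 s H3 (Rlt_le _ _ Hs)).
  set (da := fun u => i * m / (sigma * sqrt (t3 + i ^ 2 * u))
     - log_a1 sigma m c i t3 x u * i ^ 2 / (2 * (t3 + i ^ 2 * u))).
  set (db := fun u => m / (sigma * sqrt u) - log_a2 sigma m k x u / (2 * u)).
  set (dr := fun u => i * t3 / (2 * sqrt u * sqrt (t3 + i ^ 2 * u) ^ 3)).
  set (a := fun z => log_a1 sigma m c i t3 z s).
  set (b := fun z => log_a2 sigma m k z s).
  set (t := corr i t3 s) in *.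
  set (p := i / (sigma * sqrt (t3 + i ^ 2 * s))).
  set (o := / (sigma * sqrt s)).
  assert (Ha : forall z, is_derive a z p)
    by (intros; apply is_derive_log_a1_space; assumption).
  assert (Hb : forall z, is_derive b z o)
    by (intros; apply is_derive_log_a2_space; assumption).
  exists (fun z => conditional_cdf (a z) (b z) t * p + conditional_cdf (b z) (a z) t * o),
    (conditional_cdf (a x) (b x) t * da s + conditional_cdf (b x) (a x) t * db s
     + binormal_pdf (a x) (b x) t * dr s),
    ((- a x * conditional_cdf (a x) (b x) t * p + binormal_pdf (a x) (b x) t * (o - t * p)) * p
     + (- b x * conditional_cdf (b x) (a x) t * o
        + binormal_pdf (b x) (a x) t * (p - t * o)) * o).
  split; [| split; [| split]].
  - apply (is_derive_plackett (log_a1 sigma m c i t3 x) (log_a2 sigma m k x) (corr i t3)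
             da db dr); [| | | | exact Hr].
    + assert (Hl : locally s (fun u => 0 < u))
        by (apply (locally_interval _ s 0 p_infty); simpl; auto).
      generalize Hl; apply filter_imp; intros u Hu; split; [| split].
      * apply is_derive_log_a1_time; assumption.
      * apply is_derive_log_a2_time; assumption.
      * apply is_derive_corr; assumption.
    + apply (ex_derive_continuous da); unfold da, log_a1; auto_derive.
      simpl in *; repeat split; try lra; apply Rgt_not_eq, Rmult_lt_0_compat; lra.
    + apply (ex_derive_continuous db); unfold db, log_a2; auto_derive.
      simpl in *; repeat split; try lra; apply Rgt_not_eq, Rmult_lt_0_compat; lra.
    + apply (ex_derive_continuous dr); unfold dr; auto_derive.
      simpl in *; repeat split; try lra.
      apply Rgt_not_eq; repeat apply Rmult_lt_0_compat; lra.
  - intros z; evar_last.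
    + apply (is_derive_plackett a b (fun _ => t) (fun _ => p) (fun _ => o) (fun _ => 0));
        try apply continuous_const; [| exact Hr].
      apply filter_forall; intros u; split; [apply Ha |]; split; [apply Hb |].
      apply (is_derive_const t u).
    + simpl; ring.
  - assert (H1 := is_derive_conditional_cdf a b x p o t (Ha x) (Hb x) Hr).
    assert (H2 := is_derive_conditional_cdf b a x o p t (Hb x) (Ha x) Hr).
    set (f1 := fun y => conditional_cdf (a y) (b y) t) in *.
    set (f2 := fun y => conditional_cdf (b y) (a y) t) in *.
    apply (is_derive_ext (fun z => f1 z * p + f2 z * o)); [reflexivity |].
    auto_derive.
    + repeat split; eexists; eassumption.
    + rewrite (is_derive_unique (fun x : R => f1 x) _ _ H1).
      rewrite (is_derive_unique (fun x : R => f2 x) _ _ H2); ring.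
  - rewrite (binormal_pdf_sym (b x) (a x)).
    (* The equation holds identically in the two conditional terms, the density and the bounds, so
       all of them become free letters. *)
    generalize (conditional_cdf (a x) (b x) t) (conditional_cdf (b x) (a x) t)
      (binormal_pdf (a x) (b x) t); intros C1 C2 P.
    unfold da, db, dr; fold (a x) (b x); unfold p, o, t, corr.
    generalize (a x) (b x); intros A B.
    set (D := sqrt (t3 + i ^ 2 * s)) in *; set (S := sqrt s) in *.
    rewrite <- HDD, <- HSS.
    replace t3 with (D ^ 2 - i ^ 2 * S ^ 2) by (rewrite HDD, HSS; ring).
    field; lra.
Qed.

(** * The limit of vanishing time to maturity *)

Lemma continuous_log_a1_0 (sigma m c i t3 x : R) : 0 < sigma -> 0 < t3 ->
  continuous (log_a1 sigma m c i t3 x) 0.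
Proof.
  intros Hsig H3; apply (ex_derive_continuous (log_a1 sigma m c i t3 x)).
  assert (HD := sqrt_lt_R0 _ H3).
  unfold log_a1; auto_derive; rewrite Rmult_0_r, Rplus_0_r.
  repeat split; [lra |]; apply Rgt_not_eq, Rmult_lt_0_compat; lra.
Qed.

Lemma filterlim_at_right_continuous (f : R -> R) (x l : R) :
  continuous f x -> f x = l -> filterlim f (at_right x) (locally l).
Proof.
  intros H <-; eapply filterlim_filter_le_1; [| exact H].
  apply filter_le_within.
Qed.

Lemma filterlim_mult_R {T : Type} {F : (T -> Prop) -> Prop} {FF : Filter F}
  (f g : T -> R) (lf lg : R) :
  filterlim f F (locally lf) -> filterlim g F (locally lg) ->
  filterlim (fun x => f x * g x) F (locally (lf * lg)).
Proof.
  intros Hf Hg; apply (filterlim_comp_2 f g Rmult Hf Hg).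
  apply (filterlim_mult (K := R_AbsRing) lf lg).
Qed.

Lemma filterlim_plus_R {T : Type} {F : (T -> Prop) -> Prop} {FF : Filter F}
  (f g : T -> R) (lf lg : R) :
  filterlim f F (locally lf) -> filterlim g F (locally lg) ->
  filterlim (fun x => f x + g x) F (locally (lf + lg)).
Proof.
  intros Hf Hg; apply (filterlim_comp_2 f g Rplus Hf Hg).
  apply (filterlim_plus (K := R_AbsRing) (V := R_NormedModule) lf lg).
Qed.

Lemma filterlim_sqrt_0_right : filterlim sqrt (at_right 0) (at_right 0).
Proof.
  intros P [e He].
  assert (H := continuous_sqrt 0); unfold continuous in H; rewrite sqrt_0 in H.
  assert (H1 : locally 0 (ball 0 e)) by apply locally_ball.
  destruct (H _ H1) as [d Hd]; exists d; intros y Hy Hy0.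
  apply He; [apply Hd, Hy | apply sqrt_lt_R0, Hy0].
Qed.

(** A factor tending to [(x - k) / sigma] multiplies [/ sqrt s], which tends to plus infinity. As
    [is_Rbar_mult] assigns no value to zero times infinity, the hypothesis excludes the strike
    itself. *)
Lemma filterlim_log_a2_0 (sigma m k x : R) (l : Rbar) : 0 < sigma ->
  is_Rbar_mult ((x - k) / sigma) p_infty l ->
  filterlim (log_a2 sigma m k x) (at_right 0) (Rbar_locally l).
Proof.
  intros Hsig Hl.
  apply (filterlim_ext_loc (fun s => (x + m * s - k) / sigma * / sqrt s)).
  (* The radius is arbitrary: only [0 < s] is used. *)
  { exists (mkposreal 1 Rlt_0_1); intros s _ Hs; assert (HS := sqrt_lt_R0 _ Hs).
    unfold log_a2; field; lra. }
  apply (filterlim_comp_2 (fun s => (x + m * s - k) / sigma) (fun s => / sqrt s) Rmult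
           (G := Rbar_locally (Finite ((x - k) / sigma))) (H := Rbar_locally p_infty)).
  - apply filterlim_at_right_continuous; [| field; lra].
    apply (ex_derive_continuous (fun s => (x + m * s - k) / sigma)).
    unfold Rdiv; auto_derive; trivial.
  - eapply filterlim_comp; [apply filterlim_sqrt_0_right | apply filterlim_Rinv_0_right].
  - apply (filterlim_Rbar_mult _ _ _ Hl).
Qed.

(** The square root is continuous but not differentiable at 0, hence the factor-by-factor
    argument. *)
Lemma continuous_corr_0 (i t3 : R) : 0 < t3 -> continuous (corr i t3) 0.
Proof.
  intros H3; unfold corr.
  apply (continuous_scal_r i (fun s => sqrt s / sqrt (t3 + i ^ 2 * s))).
  apply (continuous_mult sqrt (fun s => / sqrt (t3 + i ^ 2 * s))).
  - apply continuous_sqrt.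
  - apply (ex_derive_continuous (fun s => / sqrt (t3 + i ^ 2 * s))).
    assert (HD := sqrt_lt_R0 _ H3).
    auto_derive; rewrite Rmult_0_r, Rplus_0_r; repeat split; lra.
Qed.

(** Only [Nstd (a s)] and [Nstd (b s)] have to converge, so the bounds may diverge; the error is
    controlled by the correlation alone. *)
Lemma filterlim_plackett_0 (a b r : R -> R) (la lb : R) :
  filterlim (fun s => Nstd (a s)) (at_right 0) (locally la) ->
  filterlim (fun s => Nstd (b s)) (at_right 0) (locally lb) ->
  filterlim r (at_right 0) (locally 0) ->
  filterlim (fun s => plackett (a s) (b s) (r s)) (at_right 0) (locally (la * lb)).
Proof.
  intros Ha Hb Hr.
  (* The bound of [plackett_bound] after [gauss] is replaced by 1. *)
  set (e := fun z => Rabs z * / (2 * PI * sqrt (1 - z ^ 2))).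
  assert (HP := PI_RGT_0).
  assert (He : filterlim (fun s => e (r s)) (at_right 0) (locally 0)).
  { eapply filterlim_comp; [exact Hr |].
    assert (E0 : e 0 = 0) by (unfold e; rewrite Rabs_R0; ring).
    apply (filterlim_filter_le_2 e (G := locally (e 0)));
      [rewrite E0; intros P HPl; exact HPl |].
    apply (continuous_mult Rabs (fun z => / (2 * PI * sqrt (1 - z ^ 2)))).
    - apply continuous_Rabs.
    - apply (ex_derive_continuous (fun z => / (2 * PI * sqrt (1 - z ^ 2)))).
      auto_derive; replace (1 + - (0 * (0 * 1))) with 1 by ring.
      rewrite sqrt_1; repeat split; lra. }
  assert (Hd : filterlim (fun s => plackett (a s) (b s) (r s) - Nstd (a s) * Nstd (b s))
                 (at_right 0) (locally 0)).
  { apply (filterlim_locally (F := at_right 0)); intros eps.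
    assert (Hr1 : at_right 0 (fun s => -1 < r s < 1)).
    { apply (Hr (fun z => -1 < z < 1)).
      apply (locally_interval _ 0 (-1) 1); simpl; intros; lra. }
    assert (He1 := proj1 (filterlim_locally (F := at_right 0) _ _) He eps).
    generalize (filter_and _ _ Hr1 He1); apply filter_imp; intros s [H1 H2].
    unfold ball in *; simpl in *; unfold AbsRing_ball, abs, minus, plus, opp in *; simpl in *.
    rewrite Ropp_0, Rplus_0_r in *.
    apply Rle_lt_trans with (1 := plackett_bound _ _ _ H1).
    apply Rle_lt_trans with (2 := H2).
    apply Rle_trans with (2 := Rle_abs _); unfold e, Rdiv.
    assert (Hs := sqrt_one_minus_sqr_pos _ H1).
    assert (Hw : 0 <= Rabs (r s) * / (2 * PI * sqrt (1 - r s ^ 2))).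
    { apply Rmult_le_pos; [apply Rabs_pos |].
      left; apply Rinv_0_lt_compat; nra. }
    change (r s * (r s * 1)) with (r s ^ 2).
    assert (Hg := gauss_le_1 (a s)); nra. }
  replace (la * lb) with (0 + la * lb) by ring.
  apply (filterlim_ext (fun s => (plackett (a s) (b s) (r s) - Nstd (a s) * Nstd (b s))
           + Nstd (a s) * Nstd (b s))); [intros; ring |].
  apply filterlim_plus_R; [exact Hd | apply filterlim_mult_R; assumption].
Qed.

Theorem theorem1 (sigma r q T beta i L K t1 t2 t3 : R)
  (Hsigma : 0 < sigma) (HT : 0 < T) (HL : 0 < L) (HK : 0 <= K) (Ht3 : 0 < t3) :
  let V := Vsol r q sigma beta i L K t1 t2 t3 in
  (* PDE, written in tau = T - t, so dV/dt = - dV/dtau, for 0 < t < T, X > 0 *)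
  (forall X tau, 0 < X -> 0 < tau < T ->
     exists Vtau VX VXX : R,
       is_derive (fun s => V X s) tau Vtau /\
       (forall Y, 0 < Y -> ex_derive (fun Z => V Z tau) Y) /\
       is_derive (fun Y => V Y tau) X VX /\
       is_derive (fun Y => Derive (fun Z => V Z tau) Y) X VXX /\
       - Vtau + / 2 * sigma ^ 2 * X ^ 2 * VXX + (r - q) * X * VX - r * V X tau = 0)
  /\
  (* terminal condition at t = T (tau -> 0+), at every X > 0 off the strike *)
  (forall X, 0 < X -> X <> K ->
     filterlim (fun tau => V X tau) (at_right 0)
       (locally (payoff r q sigma beta i L K t1 t2 t3 X))).
Proof.
  intros V; unfold V; clear V.
  set (m := drift r q sigma beta); set (c := shift r q sigma L t1 t2).
  split.
  - intros X tau HX [Htau _].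
    destruct (Req_dec K 0) as [-> | HK0].
    + destruct (heat_equation_Nstd sigma m c i t3 (ln X) tau Hsigma Ht3 Htau)
        as (Wx & Wt & Wxx & H1 & H2 & H3 & H4).
      eapply (black_scholes_log_reduction sigma r q beta _
        (fun z u => Nstd (log_a1 sigma m c i t3 z u))); try eassumption.
      intros; apply Vsol_zero_strike; assumption.
    + destruct (heat_equation_plackett sigma m c (ln K) i t3 (ln X) tau Hsigma Ht3 Htau)
        as (Wx & Wt & Wxx & H1 & H2 & H3 & H4).
      eapply (black_scholes_log_reduction sigma r q beta _
        (fun z u => plackett (log_a1 sigma m c i t3 z u) (log_a2 sigma m (ln K) z u)
                      (corr i t3 u))); try eassumption.
      intros; apply Vsol_pos_strike; lra.
  - intros X HX HXK; unfold payoff.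
    (* At zero time the contribution of [beta] to the first bound vanishes, so the payoff's argument
       is [log_a1] at 0. *)
    assert (Ha0 : delta r q sigma (Rpower X i / L) t1 t2 t3 = log_a1 sigma m c i t3 (ln X) 0).
    { unfold m, c; rewrite <- (delta_a1 r q sigma beta) by assumption.
      now rewrite !Rmult_0_r, !Rplus_0_r. }
    rewrite Ha0.
    assert (HE : filterlim (fun s => Rpower X beta * exp (mu r q sigma beta * s))
                   (at_right 0) (locally (Rpower X beta))).
    { apply filterlim_at_right_continuous; [| rewrite Rmult_0_r, exp_0; ring].
      apply (ex_derive_continuous (fun s => Rpower X beta * exp (mu r q sigma beta * s))).
      auto_derive; trivial. }
    assert (HN : filterlim (fun s => Nstd (log_a1 sigma m c i t3 (ln X) s)) (at_right 0)
                   (locally (Nstd (log_a1 sigma m c i t3 (ln X) 0)))).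
    { apply filterlim_at_right_continuous; [| reflexivity].
      apply (continuous_comp (log_a1 sigma m c i t3 (ln X)) Nstd).
      - apply continuous_log_a1_0; assumption.
      - apply continuous_Nstd. }
    destruct (Req_dec K 0) as [-> | HK0].
    + destruct (Rlt_dec 0 X) as [_ | E]; [rewrite Rmult_1_r | contradiction].
      apply (filterlim_ext_loc (fun s => Rpower X beta * exp (mu r q sigma beta * s)
        * Nstd (log_a1 sigma m c i t3 (ln X) s))).
      * exists (mkposreal 1 Rlt_0_1); intros s _ Hs.
        symmetry; apply Vsol_zero_strike; assumption.
      * apply filterlim_mult_R; assumption.
    + assert (HKp : 0 < K) by lra.
      apply (filterlim_ext_loc (fun s => Rpower X beta * exp (mu r q sigma beta * s)
        * plackett (log_a1 sigma m c i t3 (ln X) s) (log_a2 sigma m (ln K) (ln X) s)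
            (corr i t3 s))).
      { exists (mkposreal 1 Rlt_0_1); intros s _ Hs.
        symmetry; apply Vsol_pos_strike; assumption. }
      rewrite Rmult_assoc; apply filterlim_mult_R; [exact HE |].
      apply filterlim_plackett_0; [exact HN | |].
      * assert (Hs : 0 < / sigma) by (apply Rinv_0_lt_compat, Hsigma).
        (* The sign of [ln X - ln K] sends the second bound to plus or minus infinity, and the limit
           1 or 0 of [Nstd] reproduces the indicator. *)
        destruct (Rlt_dec K X) as [E | E].
        { eapply filterlim_comp; [| exact is_lim_Nstd_p].
          apply (filterlim_log_a2_0 sigma m (ln K) (ln X) p_infty); [assumption |].
          apply is_Rbar_mult_sym, is_Rbar_mult_p_infty_pos; simpl.
          assert (H := ln_increasing K X HKp E); unfold Rdiv; nra. }
        { eapply filterlim_comp; [| exact is_lim_Nstd_m].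
          apply (filterlim_log_a2_0 sigma m (ln K) (ln X) m_infty); [assumption |].
          apply is_Rbar_mult_sym, is_Rbar_mult_p_infty_neg; simpl.
          assert (E' : X < K) by lra.
          assert (H := ln_increasing X K HX E'); unfold Rdiv; nra. }
      * apply filterlim_at_right_continuous; [apply continuous_corr_0, Ht3 |].
        unfold corr; rewrite sqrt_0; unfold Rdiv; ring.
Qed.
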